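(* There exists a probabilistic classical algorithm which, given a 2-colex with $V$ vertices and $F$ faces (through its vertex-face incidence matrix $B$), an inverse temperature $\beta$, couplings $\{J_a\}_{a\in\mathcal{V}}$, an accuracy $\epsilon>0$ and a success probability $p<1$, has runtime $$O\Big(V^3\cdot\frac{1}{\epsilon^2}\cdot\log\frac{1}{1-p}\Big)$$ and outputs an estimate $\mathcal{Z}_{\mathrm{est}}$ of the partition function $\mathcal{Z}$ of the associated 3-body Ising model such that the inequality $$|\mathcal{Z}_{\mathrm{est}}-\mathcal{Z}|\le \frac{\gamma}{\sqrt{2^{F-2}}}\cdot\epsilon$$ is satisfied with probability at least $p$, where $$\gamma=\sqrt{2^{F+2}}\prod_{a\in\mathcal{V}}\sqrt{e^{2\beta J_a}+e^{-2\beta J_a}}.$$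
   Context: A 2-colex is a finite connected graph embedded cellularly (all faces are discs) in a closed orientable surface of arbitrary genus $g\ge 0$ such that every vertex has degree 3 and the faces are 3-colorable (each face can be given one of three colors so that faces sharing an edge have different colors). $\mathcal{V}$ and $\mathcal{F}$ are its vertex and face sets, $V=|\mathcal{V}|$, $F=|\mathcal{F}|$. Each vertex $a$ is adjacent to exactly three faces, denoted $\mathfrak{f}_a,\mathfrak{g}_a,\mathfrak{h}_a$. The vertex-face incidence matrix $B$ is the $V\times F$ matrix with $B_{v,\mathfrak{f}}=1$ if $v\in\mathfrak{f}$ and $0$ otherwise. The associated 3-body Ising model: a spin $\sigma_{\mathfrak{f}}\in\{1,-1\}$ is placed on each face; for real (site-dependent, positive or negative) couplings $J_a$, $a\in\mathcal{V}$, the energy of a configuration $\sigma=(\sigma_{\mathfrak{f}})_{\mathfrak{f}\in\mathcal{F}}$ is $H(\sigma)=-\sum_{a\in\mathcal{V}}J_a\,\sigma_{\mathfrak{f}_a}\sigma_{\mathfrak{g}_a}\sigma_{\mathfrak{h}_a}$. With real inverse temperature $\beta\ge 0$, the partition function is $\mathcal{Z}=\sum_{\sigma}e^{-\beta H(\sigma)}$, the sum being over all $2^F$ configurations. Runtime counts elementary operations, with real arithmetic and elementary functions at unit cost and access to random bits. The $O(\cdot)$ refers to the regime $V\to\infty$, $\epsilon\to 0$, $p\to 1$. The constant is absolute (independent of the colex, $\beta$ and the $J_a$). The estimate may be a complex number. *)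

(* Defs.v *)
From HB Require Import structures.
From mathcomp Require Import all_boot all_order all_fingroup all_algebra.
From mathcomp Require Import boolp reals sequences exp trigo.
From mathcomp Require Import complex.

Set Implicit Arguments.
Unset Strict Implicit.
Unset Printing Implicit Defensive.

Import Order.TTheory GRing.Theory Num.Theory.

Local Open Scope ring_scope.

(** * 2-colexes

   A cellular embedding of a finite connected graph in a closed orientable
   surface is given by its rotation system (combinatorial map).  A dart is an
   edge with a chosen end: [edge] sends a dart to the opposite dart of the same
   edge, and [node] is the rotation of the darts around their vertex, so the
   vertices are the cycles of [node].  The faces are the cycles of
   [edge * node], i.e. of [x |-> node (edge x)]; the two sides of the edge
   carrying [x] are the faces of [x] and of [edge x].  Every genus is allowed,
   and so are parallel edges (loops are excluded by the colouring).  Vertices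
   and faces are labelled, in an arbitrary order, by ['I_V] and ['I_F]. *)

Record colex (V F : nat) := Colex {
  dart : finType;
  edge : {perm dart};
  node : {perm dart};
  vertex_of : dart -> 'I_V;
  face_of : dart -> 'I_F;
  edgeK : involutive edge;
  edge_neq : forall x, edge x != x;
  connected_darts : forall x y,
    connect [rel u v | (v == edge u) || (v == node u)] x y;
  degree3 : forall x, #|porbit node x| = 3;
  vertex_ofP : forall x y, vertex_of x = vertex_of y <-> y \in porbit node x;
  vertex_of_surj : forall a, exists x, vertex_of x = a;
  face_ofP : forall x y,
    face_of x = face_of y <-> y \in porbit (edge * node)%g x;
  face_of_surj : forall f, exists x, face_of x = f;
  (* excludes the empty graph *)
  vertex_gt0 : (0 < V)%N;
  three_colorable : exists color : 'I_F -> 'I_3,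
    forall x, color (face_of x) != color (face_of (edge x))
}.

Section ThreeBodyIsing.
Context {V F : nat} (G : colex V F).

Definition incident (a : 'I_V) (f : 'I_F) : bool :=
  [exists x : dart G, (vertex_of x == a) && (face_of x == f)].

Definition incidence_matrix : 'M[nat]_(V, F) :=
  \matrix_(a, f) (incident a f : nat).

Lemma face_of_node (x : dart G) : face_of (node G x) = face_of (edge G x).
Proof.
apply/esym/face_ofP.
have -> : node G x = (edge G * node G)%g (edge G x) by rewrite permM edgeK.
by have := mem_porbit (edge G * node G)%g 1 (edge G x); rewrite expg1.
Qed.

Lemma card_incident_faces (a : 'I_V) : #|[set f | incident a f]| = 3.
Proof.
have [color colP] := three_colorable G.
have [x xa] := vertex_of_surj G a.
have neqn y : face_of y != face_of (node G y).
  by apply: contra (colP y) => /eqP; rewrite face_of_node => ->.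
have x3 : node G (node G (node G x)) = x.
  by have := iter_porbit (node G) x; rewrite degree3.
have orb y : y \in porbit (node G) x =
    [|| y == x, y == node G x | y == node G (node G x)].
  by rewrite porbit_traject degree3 !inE.
have -> : [set f | incident a f] =
    face_of x |: [set face_of (node G x); face_of (node G (node G x))].
  apply/setP => f; rewrite !inE; apply/existsP/idP.
    move=> [y /andP[/eqP ya /eqP <-]].
    have : y \in porbit (node G) x by apply/vertex_ofP; rewrite xa ya.
    by rewrite orb => /or3P[] /eqP ->; rewrite eqxx ?orbT.
  have vx y : y \in porbit (node G) x -> vertex_of y = a.
    by move=> /vertex_ofP <-.
  by case/or3P=> /eqP ->; [exists x | exists (node G x)
    | exists (node G (node G x))]; rewrite eqxx andbT vx // orb eqxx ?orbT.
have neq2 : face_of x != face_of (node G (node G x)).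
  by rewrite -{1}x3 eq_sym neqn.
by rewrite cardsU1 cards2 !inE negb_or !neqn neq2.
Qed.

(* In particular the natural-number subtraction [F - 2] is never truncated. *)
Lemma colex_face_ge3 : (3 <= F)%N.
Proof.
have := max_card [set f | incident (Ordinal (vertex_gt0 G)) f].
by rewrite card_incident_faces card_ord.
Qed.

Context {R : realType}.
Implicit Types (s : {ffun 'I_F -> bool}) (J : 'I_V -> R) (beta : R).

(* [false] encodes spin +1 and [true] encodes spin -1. *)
Definition spin s (f : 'I_F) : R := (-1) ^+ s f.

(* By [card_incident_faces], the inner product has exactly three factors. *)
Definition energy J s : R :=
  - \sum_(a < V) J a * \prod_(f < F | incident a f) spin s f.

Definition partition_function beta J : R :=
  \sum_(s : {ffun 'I_F -> bool}) expR (- beta * energy J s).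

Definition scale_gamma beta J : R :=
  Num.sqrt (2 ^+ (F + 2)) *
  \prod_(a < V) Num.sqrt (expR (2 * beta * J a) + expR (- 2 * beta * J a)).

End ThreeBodyIsing.

(** * Probabilistic real random access machine

   Programs are finite objects, written independently of the input and without
   real constants.  The memory consists of integer cells and real cells, both
   indexed by [nat]; addresses are computed, so indirect addressing is
   available.  There is no conversion from reals to integers (no floor). *)

Inductive iexp :=
  | INum of nat
  | ICell of iexp
  | IAdd of iexp & iexp
  | ISub of iexp & iexp
  | IMul of iexp & iexp.

Inductive rexp :=
  | ROfInt of iexp
  | RCell of iexp
  | RAdd of rexp & rexp
  | RSub of rexp & rexp
  | RMul of rexp & rexp
  | RDiv of rexp & rexp
  | RSqrt of rexp
  | RExp of rexp
  | RLn of rexp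
  | RSin of rexp
  | RCos of rexp
  | RAtan of rexp.

Inductive bexp :=
  | BIEq of iexp & iexp
  | BILe of iexp & iexp
  | BREq of rexp & rexp
  | BRLe of rexp & rexp
  | BNot of bexp
  | BAnd of bexp & bexp.

Inductive cmd :=
  | Skip
  | ISet of iexp & iexp    (* integer cell at the first address := value *)
  | RSet of iexp & rexp    (* real cell at the given address := value *)
  | Toss of iexp           (* integer cell := fresh random bit *)
  | Seq of cmd & cmd
  | If of bexp & cmd & cmd
  | While of bexp & cmd.

Section Semantics.
Variable R : realType.

(* [coins] is the stream of random bits that have not been read yet. *)
Record state := State {
  ints : nat -> nat;
  reals : nat -> R;
  coins : nat -> bool
}.

Definition update {T : Type} (m : nat -> T) (i : nat) (v : T) : nat -> T :=
  fun j => if j == i then v else m j.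

Definition set_int (s : state) i v :=
  State (update (ints s) i v) (reals s) (coins s).

Definition set_real (s : state) i v :=
  State (ints s) (update (reals s) i v) (coins s).

Definition toss_int (s : state) i :=
  State (update (ints s) i (coins s 0%N : nat)) (reals s)
        (fun k => coins s k.+1).

Fixpoint ieval (s : state) (e : iexp) : nat :=
  match e with
  | INum n => n
  | ICell a => ints s (ieval s a)
  | IAdd a b => ieval s a + ieval s b
  | ISub a b => ieval s a - ieval s b
  | IMul a b => ieval s a * ieval s b
  end%N.

(* Out of their domains, division, [Num.sqrt] and [ln] return 0. *)
Fixpoint reval (s : state) (e : rexp) : R :=
  match e with
  | ROfInt a => (ieval s a)%:R
  | RCell a => reals s (ieval s a)
  | RAdd a b => reval s a + reval s b
  | RSub a b => reval s a - reval s b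
  | RMul a b => reval s a * reval s b
  | RDiv a b => reval s a / reval s b
  | RSqrt a => Num.sqrt (reval s a)
  | RExp a => expR (reval s a)
  | RLn a => ln (reval s a)
  | RSin a => sin (reval s a)
  | RCos a => cos (reval s a)
  | RAtan a => atan (reval s a)
  end.

Fixpoint beval (s : state) (e : bexp) : bool :=
  match e with
  | BIEq a b => ieval s a == ieval s b
  | BILe a b => (ieval s a <= ieval s b)%N
  | BREq a b => reval s a == reval s b
  | BRLe a b => reval s a <= reval s b
  | BNot a => ~~ beval s a
  | BAnd a b => beval s a && beval s b
  end.

(* Evaluating an expression costs one unit per node of its syntax tree. *)
Fixpoint icost (e : iexp) : nat :=
  match e with
  | INum _ => 1
  | ICell a => (icost a).+1
  | IAdd a b | ISub a b | IMul a b => (icost a + icost b).+1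
  end.

Fixpoint rcost (e : rexp) : nat :=
  match e with
  | ROfInt a | RCell a => (icost a).+1
  | RAdd a b | RSub a b | RMul a b | RDiv a b => (rcost a + rcost b).+1
  | RSqrt a | RExp a | RLn a | RSin a | RCos a | RAtan a => (rcost a).+1
  end.

Fixpoint bcost (e : bexp) : nat :=
  match e with
  | BIEq a b | BILe a b => (icost a + icost b).+1
  | BREq a b | BRLe a b => (rcost a + rcost b).+1
  | BNot a => (bcost a).+1
  | BAnd a b => (bcost a + bcost b).+1
  end.

(* [exec c s t s']: started in [s], the program [c] halts in [s'] after exactly
   [t] elementary operations. *)
Inductive exec : cmd -> state -> nat -> state -> Prop :=
  | ExecSkip s : exec Skip s 1 s
  | ExecISet s a e :
      exec (ISet a e) s (icost a + icost e).+1
           (set_int s (ieval s a) (ieval s e))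
  | ExecRSet s a e :
      exec (RSet a e) s (icost a + rcost e).+1
           (set_real s (ieval s a) (reval s e))
  | ExecToss s a :
      exec (Toss a) s (icost a).+1 (toss_int s (ieval s a))
  | ExecSeq c1 c2 s1 s2 s3 t1 t2 :
      exec c1 s1 t1 s2 -> exec c2 s2 t2 s3 ->
      exec (Seq c1 c2) s1 (t1 + t2) s3
  | ExecIfTrue b c1 c2 s s' t :
      beval s b -> exec c1 s t s' ->
      exec (If b c1 c2) s (bcost b + t).+1 s'
  | ExecIfFalse b c1 c2 s s' t :
      ~~ beval s b -> exec c2 s t s' ->
      exec (If b c1 c2) s (bcost b + t).+1 s'
  | ExecWhileFalse b c s :
      ~~ beval s b -> exec (While b c) s (bcost b).+1 s
  | ExecWhileTrue b c s1 s2 s3 t1 t2 :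
      beval s1 b -> exec c s1 t1 s2 -> exec (While b c) s2 t2 s3 ->
      exec (While b c) s1 (bcost b + t1 + t2).+1 s3.

(* An input is an initial state that still lacks its random bits. *)
Implicit Types (init : (nat -> bool) -> state).

(* Worst-case running time, over all sequences of random bits. *)
Definition runtime_le (c : cmd) init (x : R) : Prop :=
  forall w, exists t s', exec c (init w) t s' /\ t%:R <= x.

(* A run of at most [n] steps reads at most [n] random bits, so the probability
   of an event is its frequency among the [2 ^ n] strings of [n] bits, whatever
   the choice of such an [n]; the padding bits are never read. *)
Definition bit_stream n (w : n.-tuple bool) : nat -> bool := nth false w.

Definition halts_with_probability (c : cmd) init (good : state -> Prop)
    (p : R) : Prop :=
  exists n : nat, runtime_le c init n%:R /\
    p <= #|[set w : n.-tuple bool |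
             `[< exists t s', exec c (init (bit_stream w)) t s' /\ good s' >]]|%:R
         / 2 ^+ n.

(* Integer cells: V, F, then the entries of B row by row.  Real cells: beta,
   epsilon, p, then the couplings.  All the other cells contain 0. *)
Definition input V F (B : 'M[nat]_(V, F)) (beta : R) (J : 'I_V -> R)
    (eps p : R) : (nat -> bool) -> state :=
  State (nth 0%N (V :: F :: [seq B a f | a <- enum 'I_V, f <- enum 'I_F]))
        (nth 0 (beta :: eps :: p :: [seq J a | a <- enum 'I_V])).

(* The output is a complex number, read off the first two real cells. *)
Definition output (s : state) : R[i] := Complex (reals s 0) (reals s 1).

Definition dist_to_real (z : R[i]) (x : R) : R :=
  ComplexField.Normc.normc (z - Complex x 0).

End Semantics.

(* Main.v *)
Require Import Defs.
From mathcomp Require Import all_boot all_order all_fingroup all_algebra.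
From mathcomp Require Import boolp reals sequences exp trigo.
From mathcomp Require Import complex.
From mathcomp Require Import zify ring lra.

(* Write [f_a] for the Boltzmann weight of the vertex [a] as a function of the
   parity of its three spins.  The partition function is the sum, over all spin
   configurations [s], of the products of the [f_a] at the word [B s], and these
   words run through the binary code [C] spanned by the faces, each taken
   [#|ker B| <= 4] times.  Gaussian elimination yields a set of pivot vertices on
   which the words of [C] are determined and arbitrary.  Any two faces share an
   even number of vertices, so [C] is self-orthogonal, and hence a word of [C] is
   also determined by its letters off the pivots.  Drawing the pivot letters from
   the product law [f_a ^ 2 / norm(f_a) ^ 2] therefore gives an importance
   sampling estimator of second moment [O(\prod_a norm(f_a) ^ 2)]: the squares of
   the pivot factors cancel against the law, and the remaining factors are summed
   over distinct restrictions.  The law is rounded to multiples of [1 / N], [N]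
   being a power of 2 in [2 V, 4 V[, which costs a factor [(1 - 1 / N) ^- V <= 2].
   Truncating each sample at [O(1 / eps)] makes its exponential moments finite, so
   that a Bernstein bound applies to the mean of [O(eps ^- 2 ln (1 / (1 - p)))]
   samples.  The elimination is redone for each sample, at cost [O(V ^ 3)]. *)

Set Implicit Arguments.
Unset Strict Implicit.
Unset Printing Implicit Defensive.

Import Order.TTheory GRing.Theory Num.Theory.

Local Open Scope ring_scope.

(** * The code spanned by the faces *)

Section ColexCode.
Context {V F : nat} (G : colex V F).
Implicit Types (s t : 'I_F -> bool) (x y : dart G).

(** The letter at [a] of the codeword [B s] over the field with two elements; it is [true] when the
    product of the three spins around [a] is -1. *)
Definition vertex_parity s (a : 'I_V) : bool :=
  \big[addb/false]_(f < F | incident G a f) s f.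

Lemma node3 x : node G (node G (node G x)) = x.
Proof. by have := iter_porbit (node G) x; rewrite degree3. Qed.

Lemma mem_porbit_node x y : y \in porbit (node G) x =
  [|| y == x, y == node G x | y == node G (node G x)].
Proof. by rewrite porbit_traject degree3 !inE. Qed.

Lemma vertex_of_node x : vertex_of (node G x) = vertex_of x.
Proof. by apply/esym/vertex_ofP; rewrite mem_porbit_node eqxx orbT. Qed.

Lemma face_of_node_neq x : face_of x != face_of (node G x).
Proof.
have [color colP] := three_colorable G.
by apply: contra (colP x) => /eqP; rewrite face_of_node => ->.
Qed.

Lemma incidentE x f : incident G (vertex_of x) f =
  (f \in [:: face_of x; face_of (node G x); face_of (node G (node G x))]).
Proof.
rewrite !inE; apply/existsP/idP => [[y /andP[/eqP yx /eqP <-]]|].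
  have /vertex_ofP := esym yx.
  by rewrite mem_porbit_node => /or3P[] /eqP ->; rewrite eqxx ?orbT.
by case/or3P=> /eqP ->; [exists x | exists (node G x)
  | exists (node G (node G x))]; rewrite ?vertex_of_node !eqxx.
Qed.

Lemma vertex_parity_dart s x : vertex_parity s (vertex_of x) =
  s (face_of x) (+) s (face_of (node G x)) (+) s (face_of (node G (node G x))).
Proof.
rewrite /vertex_parity (eq_bigl _ _ (incidentE x)) -big_uniq /=; last first.
  rewrite !inE negb_or !face_of_node_neq /= andbT.
  by rewrite -[x in face_of x](node3 x) eq_sym face_of_node_neq.
by rewrite !big_cons big_nil addbF addbA.
Qed.

Lemma card_vertex_darts (a : 'I_V) : #|[pred x : dart G | vertex_of x == a]| = 3.
Proof.
have [x <-] := vertex_of_surj G a.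
rewrite -(degree3 x); apply: eq_card => y; rewrite inE.
by apply/eqP/idP => [/esym/vertex_ofP|/vertex_ofP].
Qed.

(** Each vertex carries three darts, an odd number, so modulo 2 it counts once. *)
Lemma sum_darts (h : 'I_V -> bool) :
  \big[addb/false]_(x : dart G) h (vertex_of x) = \big[addb/false]_a h a.
Proof.
rewrite (partition_big (@vertex_of _ _ G) xpredT) //=; apply: eq_bigr => a _.
rewrite (eq_bigr (fun=> h a)) => [|x /eqP -> //].
by rewrite big_const card_vertex_darts /= addbF; case: (h a).
Qed.

Lemma sum_darts_node (h : dart G -> bool) :
  \big[addb/false]_x h (node G x) = \big[addb/false]_x h x.
Proof. by rewrite [RHS](reindex_inj (@perm_inj _ (node G))). Qed.

Lemma sum_darts_edge (h : dart G -> bool) :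
  \big[addb/false]_x h (edge G x) = \big[addb/false]_x h x.
Proof. by rewrite [RHS](reindex_inj (@perm_inj _ (edge G))). Qed.

(* Around a face of the colex the faces on the other side of its edges
   alternate between the two remaining colours. *)
Lemma even_face_sum (h : 'I_F -> bool) :
  \big[addb/false]_(x : dart G) h (face_of x) = false.
Proof.
have [color colP] := three_colorable G.
pose next x := node G (edge G x).
(* [P] separates the two colours possible across the edge of [x], given the colour of the face of
   [x]. *)
pose P x := (color (face_of (edge G x)) : nat) == ((color (face_of x)).+1 %% 3)%N.
have face_next x : face_of (next x) = face_of x.
  by rewrite face_of_node edgeK.
have Pnext x : P (next x) = ~~ P x.
  rewrite /P face_next.
  (* The face of [x], the one across [x] and the one across [next x] meet at a vertex, so their
     colours are pairwise distinct; a finite check remains. *)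
  have := colP (edge G x); have := colP (next x); have := colP (node G (next x)).
  have e1 : node G (node G (next x)) = edge G x by rewrite node3.
  rewrite -(face_of_node (node G (next x))) e1 -!(face_of_node (next x)).
  rewrite edgeK face_next.
  move: (color _) (color _) (color _) => [i ti] [j tj] [k tk].
  rewrite -!val_eqE /=; move: i j k ti tj tk.
  by move=> [|[|[|?]]] // [|[|[|?]]] // [|[|[|?]]].
(* Exactly one of [P x] and [P (next x)] holds, so [h (face_of x)] splits into two terms; reindexing
   by [next] shows that their sums over the darts agree, hence cancel. *)
rewrite (eq_bigr (fun x => (h (face_of x) && P x) (+) (h (face_of x) && P (next x)))).
  rewrite big_split /=.
  rewrite [X in _ (+) X](eq_bigr (fun x => h (face_of (next x)) && P (next x))).
    rewrite (sum_darts_edge (fun x => h (face_of (node G x)) && P (node G x))).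
    by rewrite (sum_darts_node (fun x => h (face_of x) && P x)) addbb.
  by move=> x _; rewrite face_next.
by move=> x _; rewrite Pnext; case: (h _); case: (P x).
Qed.

(* Summed over the darts, the products of [s] and [t] at distinct faces cancel in
   pairs under [edge], because [face_of (node G x) = face_of (edge G x)]. *)
Lemma vertex_parity_orth s t :
  \big[addb/false]_a (vertex_parity s a && vertex_parity t a) = false.
Proof.
rewrite -(sum_darts (fun a => vertex_parity s a && vertex_parity t a)).
pose n := node G.
pose S k x := s (face_of (iter k n x)); pose T k x := t (face_of (iter k n x)).
pose I k l := \big[addb/false]_x (S k x && T l x).
have shift k l : I k.+1 l.+1 = I k l.
  rewrite /I -[RHS](sum_darts_node (fun x => S k x && T l x)).
  by apply: eq_bigr => x _; rewrite /S /T !iterSr.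
have T3 x : T 3 x = T 0%N x by rewrite /T /= node3.
have I20 : I 2 0%N = I 0%N 1%N.
  by rewrite -(shift 0%N) -(shift 1%N); apply: eq_bigr => x _; rewrite T3.
have I02 : I 0%N 2 = I 1%N 0%N.
  by rewrite -(shift 0%N); apply: eq_bigr => x _; rewrite T3.
have I00 : I 0%N 0%N = false.
  exact: (even_face_sum (fun f => s f && t f)).
have I01 : I 0%N 1%N = I 1%N 0%N.
  rewrite /I -[RHS]sum_darts_edge; apply: eq_bigr => x _; rewrite /S /T /=.
  by rewrite !face_of_node edgeK.
(* By shift invariance and [node3], three of the nine sums equal [I 0 0], three equal [I 0 1] and
   three equal [I 1 0]. *)
transitivity ((I 0%N 0%N (+) I 0%N 1%N (+) I 0%N 2) (+)
  (I 1%N 0%N (+) I 1%N 1%N (+) I 1%N 2) (+) (I 2 0%N (+) I 2 1%N (+) I 2 2)).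
  rewrite /I -!big_split /=; apply: eq_bigr => x _; rewrite !vertex_parity_dart.
  rewrite /S /T /=; case: (s _); case: (s _); case: (s _) => //=;
  by case: (t _); case: (t _); case: (t _).
by rewrite !shift I20 I02 I00 I01; case: (I _ _).
Qed.

Lemma vertex_parityD s t a :
  vertex_parity (fun f => s f (+) t f) a = vertex_parity s a (+) vertex_parity t a.
Proof. exact: big_split. Qed.

(** A kernel element that vanishes on two of the faces at a vertex vanishes on the third one and
    then, moving along [edge] and [node], everywhere by connectedness. Its values on two faces
    therefore determine it. *)
Lemma card_parity_kernel :
  (#|[set s : {ffun 'I_F -> bool} | [forall a, ~~ vertex_parity s a]]| <= 4)%N.
Proof.
have [x0 _] := vertex_of_surj G (Ordinal (vertex_gt0 G)).
pose r (s : {ffun 'I_F -> bool}) := (s (face_of x0), s (face_of (node G x0))).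
have -> : 4%N = #|{: bool * bool}| by rewrite card_prod card_bool.
rewrite -(card_in_imset (f := r)) ?max_card // => s t.
rewrite !inE => /forallP s0 /forallP t0 [r1 r2].
pose d f := s f (+) t f.
have d0 x : d (face_of x) (+) d (face_of (node G x)) (+)
    d (face_of (node G (node G x))) = false.
  by rewrite -vertex_parity_dart vertex_parityD (negbTE (s0 _)) (negbTE (t0 _)).
pose Q x := ~~ d (face_of x) && ~~ d (face_of (node G x)).
have Qnode x : Q x -> Q (node G x).
  by rewrite /Q => /andP[a b]; move: (d0 x); rewrite (negbTE a) (negbTE b) /= => ->.
have Qedge x : Q x -> Q (edge G x).
  by rewrite /Q => /andP[a b]; rewrite -face_of_node b face_of_node edgeK a.
have Q0 : Q x0 by rewrite /Q /d r1 r2 !addbb.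
have Qall x : Q x.
  have /connectP[p pp ->] := connected_darts x0 x.
  move: (x0) Q0 pp; elim: p => //= y p IH z Qz /andP[/orP[]/eqP-> ]; apply: IH; auto.
apply/ffunP => f; have [x <-] := face_of_surj G f.
by have /andP[+ _] := Qall x; rewrite /d negb_add => /eqP.
Qed.

(** Distinct faces contain distinct darts, and there are [3 * V] darts. This keeps the elimination
    table of size [O(V ^ 2)]. *)
Lemma face_count_le : (F <= 3 * V)%N.
Proof.
have -> : (3 * V = #|dart G|)%N.
  rewrite -sum1_card (partition_big (@vertex_of _ _ G) xpredT) //=.
  rewrite (eq_bigr (fun=> 3%N)); first by rewrite sum_nat_const card_ord mulnC.
  by move=> a _; rewrite sum1_card card_vertex_darts.
rewrite -[F in (F <= _)%N]card_ord.
have sf f : exists x : dart G, face_of x == f.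
  by have [x <-] := face_of_surj G f; exists x.
rewrite -(card_imset _ (f := fun f => xchoose (sf f))) ?max_card // => f g e.
by rewrite -(eqP (xchooseP (sf f))) e (eqP (xchooseP (sf g))).
Qed.

End ColexCode.

(** * Expectations over random bits *)

Definition scons (b : bool) (w : nat -> bool) : nat -> bool :=
  fun k => if k is k'.+1 then w k' else b.

Section Expectation.
Context {R : realType}.
Implicit Types (q : nat -> bool -> R) (phi psi : (nat -> bool) -> R).

(* Bit [i] has law [q i]; the bits from the [n]-th on are read as [false]. *)
Fixpoint expect n q phi : R :=
  if n is n'.+1 then
    q 0%N false * expect n' (fun i => q i.+1) (fun w => phi (scons false w)) +
    q 0%N true * expect n' (fun i => q i.+1) (fun w => phi (scons true w))
  else phi (fun _ => false).

Definition prob_law n q :=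
  forall i, (i < n)%N -> q i false + q i true = 1 /\ forall b, 0 <= q i b.

Lemma prob_lawS n q : prob_law n.+1 q -> prob_law n (fun i => q i.+1).
Proof. by move=> ql i; exact: (ql i.+1). Qed.

Lemma eq_expect n q phi psi : phi =1 psi -> expect n q phi = expect n q psi.
Proof. by move=> /funext ->. Qed.

Lemma expectD n q phi psi :
  expect n q (fun w => phi w + psi w) = expect n q phi + expect n q psi.
Proof. by elim: n q phi psi => //= n IH q phi psi; rewrite !IH; ring. Qed.

Lemma expectZ n q c phi :
  expect n q (fun w => c * phi w) = c * expect n q phi.
Proof. by elim: n q phi => //= n IH q phi; rewrite !IH; ring. Qed.

Lemma expect_cst n q c : prob_law n q -> expect n q (fun=> c) = c.
Proof.
elim: n q => //= n IH q ql; rewrite IH; last exact: prob_lawS.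
by rewrite -mulrDl (ql 0%N isT).1 mul1r.
Qed.

Lemma expect_le n q phi psi : prob_law n q ->
  (forall w, phi w <= psi w) -> expect n q phi <= expect n q psi.
Proof.
elim: n q phi psi => //= n IH q phi psi ql le_phi.
have [_ q0] := ql 0%N isT.
by apply: lerD; apply: ler_wpM2l => //; apply: IH => //; exact: prob_lawS.
Qed.

Lemma expect_point_mass n phi :
  expect n (fun _ b => (~~ b)%:R) phi = phi (fun=> false).
Proof.
elim: n phi => //= n IH phi; rewrite !IH mul1r mul0r addr0; congr phi.
by apply/funext => -[].
Qed.

Definition fair : nat -> bool -> R := fun _ _ => 2^-1.

Lemma prob_law_fair n : prob_law n fair.
Proof. by move=> i _; split=> [|b]; rewrite /fair; lra. Qed.

Lemma expect_fairS n phi : expect n.+1 fair phi =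
  2^-1 * (expect n fair (fun w => phi (scons false w)) +
          expect n fair (fun w => phi (scons true w))).
Proof. by rewrite mulrDr. Qed.

(** Converts the frequencies in [halts_with_probability] into expectations under fair bits. *)
Lemma sum_bit_streams n phi :
  \sum_(w : n.-tuple bool) phi (bit_stream w) = 2 ^+ n * expect n fair phi.
Proof.
elim: n phi => [|n IH] phi.
  rewrite (big_pred1 (in_tuple [::])) => [|w]; last first.
    by case: w => -[|//] ?; apply/esym/eqP/val_inj.
  by rewrite expr0 mul1r /=; congr phi; apply/funext => -[].
have consE b (w : n.-tuple bool) :
    bit_stream (cons_tuple b w) = scons b (bit_stream w).
  by apply/funext => -[].
rewrite expect_fairS (partition_big (fun w : n.+1.-tuple bool => thead w) xpredT) //=.
have part b : \sum_(w : n.+1.-tuple bool | thead w == b) phi (bit_stream w) =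
    2 ^+ n * expect n fair (fun w => phi (scons b w)).
  rewrite -IH (reindex_onto (cons_tuple b) (fun w => [tuple of behead w])) /=.
    apply: eq_big => [w|w _]; last by rewrite consE.
    by rewrite theadE eqxx /=; apply/eqP/val_inj.
  by move=> w /eqP <-; rewrite [RHS]tuple_eta; apply/val_inj.
by rewrite big_bool /= !part -mulrDr addrC exprSr -mulrA mulVKf ?pnatr_eq0 //.
Qed.

Definition drop_bits n (w : nat -> bool) : nat -> bool := fun k => w (n + k)%N.

Definition local_to (T : Type) n (phi : (nat -> bool) -> T) :=
  forall w w', (forall i, (i < n)%N -> w i = w' i) -> phi w = phi w'.

Lemma drop_bits0 w : drop_bits 0 w = w.
Proof. by []. Qed.

Lemma drop_bitsD m n w : drop_bits m (drop_bits n w) = drop_bits (n + m) w.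
Proof. by apply/funext => k; rewrite /drop_bits addnA. Qed.

Lemma expect_indep m n phi psi : local_to m phi ->
  expect (m + n) fair (fun w => phi w * psi (drop_bits m w)) =
  expect m fair phi * expect n fair psi.
Proof.
elim: m phi => [|m IH] phi loc.
  by rewrite /= -expectZ; apply: eq_expect => w; rewrite (loc w (fun=> false)).
have locS b : local_to m (fun w => phi (scons b w)).
  by move=> w w' e; apply: loc => -[|i] //; rewrite ltnS; exact: e.
rewrite addSn !expect_fairS -mulrA mulrDl -(IH _ (locS false)).
by rewrite -(IH _ (locS true)).
Qed.

(** Disjoint blocks of [m] bits are independent; the last [r] bits are padding, which will bring the
    length of the string up to the running time. *)
Lemma expect_iid m n r phi : local_to m phi ->
  expect (n * m + r) fair (fun w => \prod_(i < n) phi (drop_bits (i * m) w)) =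
  expect m fair phi ^+ n.
Proof.
move=> loc; elim: n => [|n IH].
  rewrite mul0n expr0 -[RHS](@expect_cst r fair); last exact: prob_law_fair.
  by apply: eq_expect => w; rewrite big_ord0.
rewrite mulSn -addnA exprS -IH -expect_indep //; apply: eq_expect => w.
rewrite big_ord_recl /= mul0n drop_bits0; congr (_ * _).
by apply: eq_bigr => i _; rewrite drop_bitsD /bump leq0n mulnDl mul1n.
Qed.

(** The first bit read is the most significant one, as in [draw_bits]. *)
Fixpoint bits_value m (w : nat -> bool) : nat :=
  if m is m'.+1 then (2 * bits_value m' w + w m')%N else 0.

Lemma bits_value_scons m b w :
  bits_value m.+1 (scons b w) = (b * 2 ^ m + bits_value m w)%N.
Proof.
elim: m => [|m IH]; first by rewrite /= muln1 addn0.
by rewrite -[LHS]/(2 * bits_value m.+1 (scons b w) + w m)%N IH expnS /=; nia.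
Qed.

Lemma bits_value_local m : local_to m (bits_value m).
Proof.
elim: m => // m IH w w' e /=; rewrite (IH w w') ?e // => i im.
by apply: e; exact: leqW.
Qed.

Lemma expect_bits_value m n (phi : nat -> (nat -> bool) -> R) :
  expect (m + n) fair (fun w => phi (bits_value m w) (drop_bits m w)) =
  (2 ^+ m)^-1 * \sum_(r < 2 ^ m) expect n fair (phi r).
Proof.
elim: m phi => [|m IH] phi.
  by rewrite expr0 invr1 mul1r big_ord_recl big_ord0 addr0.
have IHb b : expect (m + n) fair
    (fun w => phi (bits_value m.+1 (scons b w)) (drop_bits m w)) =
    (2 ^+ m)^-1 * \sum_(r < 2 ^ m) expect n fair (phi (b * 2 ^ m + r)%N).
  rewrite -(IH (fun r => phi (b * 2 ^ m + r)%N)).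
  by apply: eq_expect => w; rewrite bits_value_scons.
rewrite addSn expect_fairS (IHb false) (IHb true) exprS invfM.
rewrite expnS mul2n -addnn big_split_ord /=.
under eq_bigr do rewrite mul0n add0n.
rewrite !mul1n.
by ring.
Qed.

Definition threshold_law (N : nat) (th : nat -> nat) : nat -> bool -> R :=
  fun a b => (if b then (th a)%:R else (N - th a)%:R) / N%:R.

Lemma sum_threshold N th (x y : R) : (th <= N)%N ->
  \sum_(r < N) (if (r < th)%N then x else y) = th%:R * x + (N - th)%:R * y.
Proof.
move=> thN.
rewrite -(big_mkord xpredT (fun r => if (r < th)%N then x else y)).
rewrite (big_cat_nat (n := th)) //= !big_nat.
rewrite (eq_bigr (fun=> x)) => [|i /andP[_ ->] //].
rewrite [X in _ + X](eq_bigr (fun=> y)); last first.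
  by move=> i /andP[+ _]; rewrite leqNgt => /negbTE ->.
by rewrite -!big_nat !sumr_const_nat subn0 -[x *+ _]mulr_natl -[y *+ _]mulr_natl.
Qed.

(** Comparing a uniform integer below [2 ^ m] with [th a] gives letter [a] its law; distinct letters
    use disjoint blocks of bits and are thus independent. *)
Lemma expect_thresholds m V th phi :
  (forall a, (a < V)%N -> (th a <= 2 ^ m)%N) -> local_to V phi ->
  expect (V * m) fair
    (fun w => phi (fun a => bits_value m (drop_bits (a * m) w) < th a)%N) =
  expect V (threshold_law (2 ^ m) th) phi.
Proof.
elim: V th phi => [|V IH] th phi thN loc; first by rewrite /=; exact: loc.
have locS b : local_to V (fun w => phi (scons b w)).
  by move=> w w' e; apply: loc => -[|i] //; rewrite ltnS; exact: e.
pose rest w := fun a => (bits_value m (drop_bits (a * m) w) < th a.+1)%N.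
pose law' := threshold_law (2 ^ m) (fun a => th a.+1).
rewrite mulSn; transitivity (expect (m + V * m) fair (fun w =>
    phi (scons (bits_value m w < th 0)%N (rest (drop_bits m w))))); last first.
  rewrite (expect_bits_value m (V * m)
    (fun r w' => phi (scons (r < th 0)%N (rest w')))).
  rewrite (eq_bigr (fun r : 'I_(2 ^ m) => if (r < th 0)%N
     then expect V law' (fun w => phi (scons true w))
     else expect V law' (fun w => phi (scons false w)))).
    rewrite sum_threshold ?thN //= /law' /threshold_law natrX.
    by rewrite mulrDr !mulrA addrC; congr (_ * _ + _ * _); rewrite mulrC.
  by move=> r _; case: ifP => _; rewrite -IH //; move=> a aV; exact: thN.
apply: eq_expect => w; apply: loc => -[|a] _ /=; first by rewrite mul0n.
by rewrite /rest drop_bitsD mulSn.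
Qed.

Lemma prob_law_threshold N th V : (0 < N)%N ->
  (forall a, (a < V)%N -> (th a <= N)%N) -> prob_law V (threshold_law N th).
Proof.
move=> N0 thN a aV; rewrite /threshold_law; split=> [|b].
  by rewrite -mulrDl -natrD subnK ?thN // divff // pnatr_eq0 -lt0n.
by rewrite divr_ge0 //; case: b.
Qed.

End Expectation.

(** * Sampling by elimination *)

Section Elimination.
Context (F : nat).
Implicit Types (T : nat -> nat -> bool) (u : nat -> bool)
  (s : {ffun 'I_F -> bool}).

(* One more than the last index [j < n] with [b j], or 0. *)
Fixpoint last_one (b : nat -> bool) n : nat :=
  if n is n'.+1 then if b n' then n else last_one b n' else 0.

Lemma last_one0 b n : last_one b n = 0%N -> forall j, (j < n)%N -> b j = false.
Proof.
elim: n => //= n IH; case: ifP => // bn /IH H j.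
by rewrite ltnS leq_eqVlt => /orP[/eqP -> //|/H].
Qed.

Lemma last_oneP b n : last_one b n != 0%N ->
  exists2 j, last_one b n = j.+1 & (j < n)%N /\ b j.
Proof.
elim: n => //= n IH; case: ifP => [bn _|_ /IH[j -> [jn bj]]]; first by exists n.
by exists j => //; split=> //; exact: ltnW.
Qed.

Lemma last_one_max b n j : (last_one b n <= j < n)%N -> b j = false.
Proof.
elim: n => [|n IH] /=; first by move=> ?; exfalso; lia.
case: ifP => [_|bn]; first by move=> ?; exfalso; lia.
rewrite ltnS [(j <= n)%N]leq_eqVlt => /andP[lj /orP[/eqP -> //|jn]].
by apply: IH; rewrite lj.
Qed.

Lemma eq_last_one b b' n : (forall j, (j < n)%N -> b j = b' j) ->
  last_one b n = last_one b' n.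
Proof.
elim: n => //= n IH e; rewrite e // IH // => j jn.
by apply: e; exact: leqW.
Qed.

(* Column 0 of [T] is an affine offset, columns [1..F] are generators. *)
Definition pivot T a : nat := last_one (fun j => T a j.+1) F.

Definition flip_bit T (a : nat) c : nat -> nat -> bool :=
  fun i j => T i j (+) [&& i == a, j == 0%N & c].

(** A column operation: column [p] is added to every column with a one in row [a]. When [T a p]
    holds, column [p] cancels itself and row [a] becomes zero. *)
Definition eliminate T a p : nat -> nat -> bool :=
  fun i j => T i j (+) (T a j && T i p).

(** Conditions the affine family of words on the letter [c] at [a]. Flipping by [c] makes the
    elimination add the pivot column to the offset exactly when the offset letter at [a] differs
    from [c]. Without a pivot the letter is forced and nothing changes. *)
Definition step T a c : nat -> nat -> bool :=
  let p := pivot T a in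
  if p == 0%N then T else eliminate (flip_bit T a c) a p.

Fixpoint trajectory T a u k : nat -> nat -> bool :=
  if k is k'.+1 then step (trajectory T a u k') (a + k') (u k') else T.

Definition has_pivot T a u k : bool := pivot (trajectory T a u k) (a + k) != 0%N.

(** A pivot letter is free and taken from [u]; in any other row all generators vanish, so the offset
    dictates the letter. *)
Definition letter T a u k : bool :=
  if has_pivot T a u k then u k else trajectory T a u k (a + k)%N 0%N.

Lemma trajectoryS T a u k : trajectory T a u k.+1 =
  trajectory (step T a (u 0%N)) a.+1 (fun i => u i.+1) k.
Proof.
elim: k => [|k IH]; first by rewrite /= addn0.
by rewrite -[LHS]/(step (trajectory T a u k.+1) (a + k.+1) (u k.+1)) IH addnS.
Qed.

Lemma has_pivotS T a u k : has_pivot T a u k.+1 =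
  has_pivot (step T a (u 0%N)) a.+1 (fun i => u i.+1) k.
Proof. by rewrite /has_pivot trajectoryS addnS. Qed.

Lemma letterS T a u k : letter T a u k.+1 =
  letter (step T a (u 0%N)) a.+1 (fun i => u i.+1) k.
Proof. by rewrite /letter has_pivotS trajectoryS addnS. Qed.

Definition agree_gens T T' := forall i j, T i j.+1 = T' i j.+1.

Lemma pivot_agree T T' a : agree_gens T T' -> pivot T a = pivot T' a.
Proof. by move=> e; apply: eq_last_one => j _; exact: e. Qed.

Lemma step_agree T T' a c c' : agree_gens T T' ->
  agree_gens (step T a c) (step T' a c').
Proof.
move=> e i j; rewrite /step (pivot_agree a e).
case: eqP => // /eqP /last_oneP[k ek _].
by rewrite /pivot ek /eliminate /flip_bit /= !andbF !addbF !e.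
Qed.

(** The drawn letters only affect column 0, whereas pivots are read off the generators, so the set
    of pivots does not depend on the draw. *)
Lemma has_pivot_agree T T' a u u' k : agree_gens T T' ->
  has_pivot T a u k = has_pivot T' a u' k.
Proof.
move=> e; congr (_ != _); apply: pivot_agree.
by elim: k => //= k IH; exact: step_agree.
Qed.

Lemma trajectory_local T a k : local_to k (fun u => trajectory T a u k).
Proof.
elim: k => // k IH u u' e /=; rewrite (IH u u') ?e // => i ik.
by apply: e; exact: leqW.
Qed.

Lemma letter_local T a k n : (k < n)%N -> local_to n (fun u => letter T a u k).
Proof.
move=> kn u u' e; rewrite /letter /has_pivot e // (@trajectory_local _ _ _ u u') //.
by move=> i ik; apply: e; exact: ltn_trans ik kn.
Qed.

Lemma letter0 T a k : (forall i, T i 0%N = false) ->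
  letter T a (fun=> false) k = false.
Proof.
move=> T0; rewrite /letter; case: ifP => // _.
move: (a + k)%N; elim: k => [|k IH] i /=; first exact: T0.
rewrite {1}/step; case: ifP => _; first exact: IH.
by rewrite /eliminate /flip_bit !andbF !addbF !IH.
Qed.

Definition combination T s i : bool :=
  T i 0%N (+) \big[addb/false]_(j < F) (s j && T i j.+1).

Definition flip_coef (j0 : 'I_F) s : {ffun 'I_F -> bool} :=
  [ffun j => s j (+) (j == j0)].

Lemma flip_coefK j0 : involutive (flip_coef j0).
Proof. by move=> s; apply/ffunP => j; rewrite !ffunE addbK. Qed.

Lemma combination_flip T j0 s i :
  combination T (flip_coef j0 s) i = combination T s i (+) T i j0.+1.
Proof.
rewrite /combination -addbA; congr (_ (+) _).
rewrite -[T i j0.+1](_ : \big[addb/false]_j ((j == j0) && T i j.+1) = _).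
  by rewrite -big_split /=; apply: eq_bigr => j _; rewrite ffunE andb_addl.
by rewrite -big_mkcondr (bigD1 j0) //= big_pred0 ?addbF // => j; case: eqP.
Qed.

(** After the step, [s] yields the word of [s] or of [flip_coef j0 s], whichever has letter [c] at
    [a]. Row [a] is excluded because the elimination erases it. *)
Lemma combination_step T (a : nat) c s (i : nat) (j0 : 'I_F) :
  i != a -> pivot T a = j0.+1 ->
  combination (step T a c) s i =
  combination T s i (+) ((combination T s a (+) c) && T i j0.+1).
Proof.
move=> ia pj; rewrite /combination /step pj /= /eliminate /flip_bit /=.
rewrite (negbTE ia) eqxx /= ?andbF !addbF.
rewrite (eq_bigr (fun j : 'I_F =>
  (s j && T i j.+1) (+) ((s j && T a j.+1) && T i j0.+1))); last first.
  move=> j _; rewrite ?andbF !addbF.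
  by case: (s j); case: (T i j.+1); case: (T a j.+1).
rewrite big_split /= -big_distrl /=.
set A := \big[_/_]_(j < F) _; set B := \big[_/_]_(j < F) _.
by case: (T i 0%N); case: (T a 0%N); case: A; case: B; case: c; case: (T i _).
Qed.

Lemma pivot_ord T a : pivot T a != 0%N ->
  exists2 j0 : 'I_F, pivot T a = j0.+1 & T a j0.+1.
Proof. by move=> /last_oneP[j pj [jF Tj]]; exists (Ordinal jF). Qed.

Lemma pivot0_combination T a s : pivot T a = 0%N -> combination T s a = T a 0%N.
Proof.
move=> p0; rewrite /combination big1 ?addbF // => j _.
by rewrite (last_one0 p0) ?andbF.
Qed.

(** Every draw produces a word of the affine family: the coefficients come from the later rows by
    induction, and at a pivot row flipping the pivot coefficient corrects the letter if
    necessary. *)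
Lemma letter_combination n T a u :
  exists s, forall i, (i < n)%N -> combination T s (a + i) = letter T a u i.
Proof.
elim: n T a u => [|n IH] T a u; first by exists [ffun=> false].
have [s es] := IH (step T a (u 0%N)) a.+1 (fun i => u i.+1).
have [p0|/pivot_ord[j0 pj Tj]] := eqVneq (pivot T a) 0%N.
  exists s => -[_|i]; last first.
    by rewrite ltnS => /es; rewrite letterS -addSnnS /step p0.
  by rewrite /letter /has_pivot /= addn0 p0 /= pivot0_combination.
exists (if combination T s a == u 0%N then s else flip_coef j0 s) => -[_|i].
  rewrite /letter /has_pivot /= addn0 pj /=.
  case: eqP => //; rewrite combination_flip Tj.
  by case: (combination _ _ _); case: (u _).
rewrite ltnS => /es; rewrite letterS -addSnnS => <-.
rewrite (combination_step _ _ _ pj); last by rewrite gtn_eqF // ltnS leq_addr.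
case: eqP => [->|]; first by rewrite addbb addbF.
by rewrite combination_flip; case: (combination _ _ a); case: (u _).
Qed.

(** Exactly one of [s] and [flip_coef j0 s] has letter [c] at [a], and the step gives both the same
    later letters; hence the factor 2. *)
Lemma sum_combinations_step (R : realType) T a c (j0 : 'I_F) n
    (g : nat -> bool -> R) : pivot T a = j0.+1 -> T a j0.+1 ->
  \sum_s \prod_(i < n) g i (combination (step T a c) s (a.+1 + i)) =
  2 * \sum_(s | combination T s a == c) \prod_(i < n) g i (combination T s (a.+1 + i)).
Proof.
move=> pj Tj; rewrite (bigID (fun s => combination T s a == c)) /=.
have ne i : (a.+1 + i != a)%N by rewrite gtn_eqF // ltnS leq_addr.
rewrite mulr_natl mulr2n; congr (_ + _).
  apply: eq_bigr => s /eqP su; apply: eq_bigr => i _.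
  by rewrite (combination_step _ _ _ pj) // su addbb addbF.
rewrite (reindex_inj (inv_inj (flip_coefK j0))) /=; apply: eq_big => s.
  by rewrite combination_flip Tj; case: (combination _ _ _); case: c.
rewrite combination_flip Tj => su; apply: eq_bigr => i _.
rewrite (combination_step _ _ _ pj) // !combination_flip Tj.
rewrite [X in X && _](_ : _ = true) ?addbK //.
by move: su; case: (combination _ _ _); case: c.
Qed.

(* The sampler is unbiased: each pivot halves the set of coefficient vectors,
   and the division by the law is the importance weight. *)
Lemma expect_letters (R : realType) n T a (g q : nat -> bool -> R) :
  (forall i, (i < n)%N -> q i false + q i true = 1) ->
  (forall i b, (i < n)%N -> q i b != 0 \/ g i b = 0) ->
  2 ^+ F * expect n q (fun u => \prod_(i < n) (g i (letter T a u i) *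
    (if has_pivot T a u i then (2 * q i (letter T a u i))^-1 else 1))) =
  \sum_s \prod_(i < n) g i (combination T s (a + i)).
Proof.
elim: n T a g q => [|n IH] T a g q q1 qg.
  rewrite /= big_ord0 mulr1 (eq_bigr (fun=> 1)); last by move=> s _; rewrite big_ord0.
  by rewrite sumr_const card_ffun card_bool card_ord natrX.
pose h b := g 0%N (letter T a (fun=> b) 0) *
  (if has_pivot T a (fun=> b) 0 then (2 * q 0%N (letter T a (fun=> b) 0%N))^-1 else 1).
have expS b : 2 ^+ F * expect n (fun i => q i.+1) (fun u => \prod_(i < n.+1)
     (g i (letter T a (scons b u) i) * (if has_pivot T a (scons b u) i
       then (2 * q i (letter T a (scons b u) i))^-1 else 1))) =
  h b * \sum_s \prod_(i < n) g i.+1 (combination (step T a b) s (a.+1 + i)).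
  rewrite -(IH _ _ (fun i => g i.+1) (fun i => q i.+1)); last 2 first.
  - by move=> i; exact: (q1 i.+1).
  - by move=> i c; exact: (qg i.+1).
  rewrite [RHS]mulrCA -[h b * _]expectZ; congr (_ * _); apply: eq_expect => u.
  rewrite big_ord_recl; congr (_ * _); apply: eq_bigr => i _.
  by rewrite has_pivotS letterS.
rewrite /= mulrDr ![2 ^+ F * (_ * _)]mulrCA !expS {expS}.
have [p0|/pivot_ord[j0 pj Tj]] := eqVneq (pivot T a) 0%N.
  rewrite /h /letter /has_pivot /= addn0 p0 eqxx /= mulr1.
  rewrite /step p0 eqxx -mulrDl q1 // mul1r big_distrr /=.
  apply: eq_bigr => s _; rewrite big_ord_recl addn0 pivot0_combination //.
  by congr (_ * _); apply: eq_bigr => i _; rewrite -addSnnS.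
(* The importance weight cancels the law. Where [q] vanishes the inverse is 0 by convention, but
   there [g] vanishes too. *)
have hE b : q 0%N b * h b = g 0%N b / 2.
  rewrite /h /letter /has_pivot /= addn0 pj /=.
  by case: (qg 0%N b isT) => [q0|->]; [field | rewrite !mul0r mulr0].
clearbody h; rewrite !mulrA !hE !(sum_combinations_step _ n (fun i => g i.+1) pj Tj).
have half x y : x / 2 * (2 * y) = x * y :> R by field.
rewrite !half addrC [RHS](bigID (fun s => combination T s a == true)) /=.
rewrite !big_distrr /=; congr (_ + _).
  apply: eq_bigr => s /eqP sa; rewrite big_ord_recl addn0 sa.
  by congr (_ * _); apply: eq_bigr => i _; rewrite -addSnnS.
apply: eq_big => s; first by case: (combination _ _ _).
move=> /eqP sa; rewrite big_ord_recl addn0 sa.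
by congr (_ * _); apply: eq_bigr => i _; rewrite -addSnnS.
Qed.

End Elimination.

(** * Tail bound and moments *)

Section TailBound.
Context {R : realType}.
Implicit Types (phi : (nat -> bool) -> R).

(** Inverting [1 - x <= expR (- x)] reduces the claim to [1 <= (1 + x + 2 * x ^+ 2) * (1 - x)], and
    this product is [1 + x ^+ 2 * (1 - 2 * x)]. *)
Lemma expR_le_quadratic (x : R) : x <= 2^-1 -> expR x <= 1 + x + 2 * x ^+ 2.
Proof.
move=> x2; have e1 : 1 - x <= expR (- x) by exact: expR_ge1Dx.
have x0 : 0 < 1 - x by lra.
have -> : expR x = (expR (- x))^-1 by rewrite expRN invrK.
apply: (@le_trans _ _ (1 - x)^-1).
  by rewrite lef_pV2 ?posrE // (lt_le_trans x0).
rewrite -[leLHS]mul1r ler_pdivrMr //.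
have : 0 <= x ^+ 2 * (1 - 2 * x) by apply: mulr_ge0; [exact: sqr_ge0 | lra].
nra.
Qed.

(** Only an upper bound on [l * phi] is assumed, so [l] may have either sign and both tails are
    covered. *)
Lemma expect_expR_le m phi (l c : R) : local_to m phi ->
  (forall w, l * phi w <= 2^-1) -> expect m fair (fun w => phi w ^+ 2) <= c ->
  expect m fair (fun w => expR (l * phi w)) <=
  expR (l * expect m fair phi + 2 * l ^+ 2 * c).
Proof.
move=> loc le2 lec.
apply: le_trans (expR_ge1Dx _).
apply: (@le_trans _ _ (expect m fair
    (fun w => 1 + (l * phi w + 2 * l ^+ 2 * phi w ^+ 2)))).
  apply: expect_le => [|w]; first exact: prob_law_fair.
  by apply: le_trans (expR_le_quadratic (le2 w)) _; rewrite exprMn mulrA addrA.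
rewrite !expectD !expectZ expect_cst; last exact: prob_law_fair.
by do 2 apply: lerD => //; apply: ler_wpM2l => //; rewrite mulr_ge0 // sqr_ge0.
Qed.

Lemma prod_expR_sum n (F : 'I_n -> R) :
  \prod_(i < n) expR (F i) = expR (\sum_(i < n) F i).
Proof. by elim/big_rec2: _ => [|i x y _ ->]; rewrite ?expR0 ?expRD. Qed.

(** The exponential moment of a Chernoff bound: independence gives the [n]-th power of
    [expect_expR_le]. The parameter [t] will be [l] times the allowed deviation. *)
Lemma expect_sum_tail m n r phi (l c t : R) : local_to m phi ->
  (forall w, l * phi w <= 2^-1) -> expect m fair (fun w => phi w ^+ 2) <= c ->
  expect (n * m + r) fair (fun w =>
    expR (l * (\sum_(i < n) phi (drop_bits (i * m) w)) -
          l * n%:R * expect m fair phi - n%:R * t))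
  <= expR (n%:R * (2 * l ^+ 2 * c - t)).
Proof.
move=> loc le2 lec; set mu := expect m fair phi.
rewrite (@eq_expect _ _ _ _ (fun w => expR (- (l * n%:R * mu) - n%:R * t) *
   \prod_(i < n) expR (l * phi (drop_bits (i * m) w)))); last first.
  move=> w; rewrite prod_expR_sum.
  by rewrite -expRD -mulr_sumr; congr expR; ring.
rewrite expectZ (expect_iid n r (phi := fun w => expR (l * phi w))); last first.
  by move=> w w' e; rewrite (loc w w').
apply: (@le_trans _ _ (expR (- (l * n%:R * mu) - n%:R * t) *
    expR (l * mu + 2 * l ^+ 2 * c) ^+ n)).
  apply: ler_wpM2l; first exact: expR_ge0.
  apply: lerXn2r; rewrite ?nnegrE ?expR_ge0 //; last exact: expect_expR_le.
  rewrite -[leLHS](@expect_cst _ m fair); last exact: prob_law_fair.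
  by apply: expect_le => [|w]; [exact: prob_law_fair | exact: expR_ge0].
rewrite -expRM_natl -expRD ler_expR.
by rewrite le_eqVlt; apply/orP; left; apply/eqP; ring.
Qed.

(* A Bernstein bound: truncating at [16 / eps] costs a bias of at most
   [2 * eps] and makes the exponential moments finite. *)
Lemma truncated_mean_estimate m n r phi (eps p : R) :
  local_to m phi -> (forall w, 0 <= phi w) ->
  expect m fair (fun w => phi w ^+ 2) <= 32 ->
  0 < eps -> 0 < p < 1 -> (0 < n)%N -> 64 * ln (2 / (1 - p)) <= n%:R * eps * eps ->
  p <= expect (n * m + r) fair (fun w =>
    (`|(\sum_(i < n) Num.min (phi (drop_bits (i * m) w)) (16 / eps)) / n%:R
       - expect m fair phi| <= 4 * eps)%R%:R).
Proof.
move=> loc phi0 lec eps0 /andP[p0 p1] n0 nE.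
pose B := 16 / eps; pose psi w := Num.min (phi w) B.
have B0 : 0 < B by rewrite divr_gt0.
have n0R : 0 < n%:R :> R by rewrite ltr0n.
have psi0 w : 0 <= psi w by rewrite le_min phi0 ltW.
have psiB w : psi w <= B by rewrite ge_min lexx orbT.
have psile w : psi w <= phi w by rewrite ge_min lexx.
have plaw := @prob_law_fair R m.
have psiloc : local_to m psi by move=> w w' e; rewrite /psi (loc w w').
have psi2 : expect m fair (fun w => psi w ^+ 2) <= 32.
  apply: le_trans lec; apply: expect_le => // w.
  by rewrite lerXn2r ?nnegrE.
have bias1 : expect m fair psi <= expect m fair phi by exact: expect_le.
have bias2 : expect m fair phi <= expect m fair psi + 2 * eps.
  (* A sample exceeding [B] is at most its square divided by [B], so the truncation loses at most
     [32 / B], which is [2 * eps]. *)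
  have -> : 2 * eps = B^-1 * 32 by rewrite /B invf_div; field.
  apply: (@le_trans _ _ (expect m fair psi + B^-1 * expect m fair (fun w => phi w ^+ 2))).
    rewrite -expectZ -expectD; apply: expect_le => // w.
    rewrite /psi; case: (leP (phi w) B) => [_|lt].
      by rewrite lerDl; apply: mulr_ge0; [rewrite invr_ge0 ltW | exact: sqr_ge0].
    rewrite mulrC -[leLHS]add0r lerD ?(ltW B0) // ler_pdivlMr // expr2.
    by rewrite ler_wpM2l // ltW.
  by rewrite lerD2l; apply: ler_wpM2l => //; rewrite invr_ge0 ltW.
set mu := expect m fair psi in bias1 bias2 *.
(* This [l] minimises [64 * l ^+ 2 - 2 * l * eps], the exponent for a deviation of [2 * eps], and
   [t] is [l * (2 * eps)]. Moreover [l * B] is [1 / 4], within the range of [expR_le_quadratic]. *)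
pose l := eps / 64; pose t := eps ^+ 2 / 32.
pose S w := \sum_(i < n) psi (drop_bits (i * m) w).
pose up w := expR (l * S w - l * n%:R * mu - n%:R * t).
pose dn w := expR ((- l) * S w - (- l) * n%:R * mu - n%:R * t).
have l0 : 0 < l by rewrite divr_gt0.
have lB : l * B = 4^-1 by rewrite /l /B; field; rewrite gt_eqF.
have rate : expR (n%:R * (2 * l ^+ 2 * 32 - t)) <= (1 - p) / 2.
  have -> : 2 * l ^+ 2 * 32 - t = - (eps ^+ 2 / 64) by rewrite /l /t; field.
  have q0 : 0 < (1 - p) / 2 by lra.
  rewrite -[leRHS]lnK ?posrE // ler_expR -[(1 - p) / 2]invrK invf_div.
  rewrite lnV ?posrE ?divr_gt0 //; last by lra.
  by rewrite mulrN lerN2; nra.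
have tail_up : expect (n * m + r) fair up <= (1 - p) / 2.
  apply: le_trans rate; apply: expect_sum_tail => // w.
  by apply: (@le_trans _ _ (l * B)); [rewrite ler_wpM2l ?(ltW l0) | rewrite lB; lra].
have tail_dn : expect (n * m + r) fair dn <= (1 - p) / 2.
  apply: le_trans rate; rewrite -[l ^+ 2]sqrrN; apply: expect_sum_tail => // w.
  by rewrite mulNr; apply: (@le_trans _ _ 0); [rewrite oppr_le0 mulr_ge0 // ltW | lra].
set good := (fun w : nat -> bool => _).
have one_le w : 1 <= good w + (up w + dn w).
  rewrite /good; case: (leP _ (4 * eps)) => [_|bad].
    by rewrite lerDl addr_ge0 ?expR_ge0.
  rewrite add0r -/(S w) in bad *.
  (* The bias uses up [2 * eps] of the tolerance [4 * eps] and leaves [2 * eps] for the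
     deviation. *)
  have {}bad : 2 * eps < `|S w / n%:R - mu|.
    by move: bad; rewrite !ltNge; apply: contra; rewrite !ler_norml; lra.
  have St : S w = n%:R * mu + n%:R * (S w / n%:R - mu).
    by field; rewrite gt_eqF.
  have lt2 : l * (2 * eps) = t by rewrite /l /t; field.
  move: bad; rewrite ltNge ler_norml negb_and -!ltNge; set d := _ - mu in St *.
  (* whichever tail contains the sample mean has exponent at least 0 *)
  move=> /orP[bad|bad].
    apply: (@le_trans _ _ (dn w)); last by rewrite lerDr expR_ge0.
    rewrite -[leLHS]expR0 ler_expR St -lt2.
    have : 0 <= (n%:R * l) * (- d - 2 * eps) by rewrite mulr_ge0 ?mulr_ge0 ?ltW //; lra.
    nra.
  apply: (@le_trans _ _ (up w)); last by rewrite lerDl expR_ge0.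
  rewrite -[leLHS]expR0 ler_expR St -lt2.
  have : 0 <= (n%:R * l) * (d - 2 * eps) by rewrite mulr_ge0 ?mulr_ge0 ?ltW //; lra.
  nra.
have := @expect_le R (n * m + r) fair (fun=> 1) _ (@prob_law_fair R _) one_le.
rewrite expect_cst; last exact: prob_law_fair.
rewrite !expectD; lra.
Qed.

End TailBound.

(** * First and second moments of the importance sampling estimator *)

Section Moments.
Context {V F : nat} (G : colex V F) {R : realType}.

Definition incidence_bit (i j : nat) : bool :=
  if insub i is Some a then
    if insub j is Some f then incident G a f else false
  else false.

Definition face_table (i j : nat) : bool :=
  if j is j'.+1 then incidence_bit i j' else false.

Lemma incidence_bitE (a : 'I_V) (f : 'I_F) : incidence_bit a f = incident G a f.
Proof. by rewrite /incidence_bit !valK. Qed.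

Lemma combination_face_table (s : {ffun 'I_F -> bool}) (a : 'I_V) :
  combination face_table s a = vertex_parity G s a.
Proof.
rewrite /combination /vertex_parity [RHS]big_mkcond /=; apply: eq_bigr => f _.
by rewrite incidence_bitE; case: incident; rewrite ?andbT ?andbF.
Qed.

Definition table_pivot (i : nat) : bool :=
  has_pivot F face_table 0 (fun=> false) i.

Lemma has_pivot_table u i : has_pivot F face_table 0 u i = table_pivot i.
Proof. exact: has_pivot_agree. Qed.

(* A codeword vanishing off the pivots is orthogonal to codewords restricting
   to every unit vector on the pivots. *)
Lemma parity_nonpivot_inj (s : {ffun 'I_F -> bool}) :
  (forall a : 'I_V, ~~ table_pivot a -> vertex_parity G s a = false) ->
  forall a, vertex_parity G s a = false.
Proof.
move=> s0 a; have [pa|] := boolP (table_pivot a); last exact: s0.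
have [t tE] := letter_combination F V face_table 0 (fun i => i == a).
have := vertex_parity_orth G s t; rewrite (bigD1 a) //= big1 => [|b ba].
  by rewrite -[vertex_parity G t a]combination_face_table (tE a) //
    /letter has_pivot_table pa eqxx andbT addbF.
have [pb|/s0 -> //] := boolP (table_pivot b).
by rewrite -[vertex_parity G t b]combination_face_table (tE b) //
  /letter has_pivot_table pb (negbTE ba : (b == a :> nat) = false) andbF.
Qed.

(** Halving [2 ^ F] once per pivot leaves the size of the kernel of [B], at most 4. The count comes
    from [expect_letters] with all the mass on the zero draw and with [g] testing each letter for
    [false]. *)
Lemma prod_pivot_le :
  2 ^+ F * \prod_(i < V) (if table_pivot i then 2^-1 else 1) <= 4 :> R.
Proof.
have := @expect_letters F R V face_table 0 (fun _ b => (~~ b)%:R)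
  (fun _ b => (~~ b)%:R).
rewrite expect_point_mass (eq_bigr (fun i : 'I_V => if table_pivot i then 2^-1 else 1)).
  move=> ->; last 2 first.
  - by move=> i _; rewrite addr0.
  - by move=> i [] _; [right | left; exact: oner_neq0].
  apply: (@le_trans _ _
    #|[set s : {ffun 'I_F -> bool} | [forall a, ~~ vertex_parity G s a]]|%:R).
    rewrite -sum1_card natr_sum [leRHS]big_mkcond /=; apply: ler_sum => s _.
    rewrite inE; case: ifPn => [_|/forallPn[a]].
      by apply: prodr_ile1 => i _; case: (~~ _); rewrite /= ?lexx ?ler01.
   by rewrite ?negbK => sa; rewrite (bigD1 a) //= add0n combination_face_table sa mul0r.
  by rewrite ler_nat card_parity_kernel.
move=> i _; rewrite letter0 // mul1r mulr1 has_pivot_table.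
by case: table_pivot.
Qed.

(** Two configurations with the same image under [rho] differ by a kernel element, so each fibre has
    at most 4 members. *)
Lemma sum_fibers_le (psi : {ffun 'I_V -> bool} -> R)
    (rho : {ffun 'I_F -> bool} -> {ffun 'I_V -> bool}) :
  (forall z, 0 <= psi z) ->
  (forall s s', rho s = rho s' -> forall a, vertex_parity G s a = vertex_parity G s' a) ->
  \sum_s psi (rho s) <= 4 * \sum_z psi z.
Proof.
move=> psi0 rho_inj; rewrite (partition_big rho xpredT) //= mulr_sumr.
apply: ler_sum => z _; rewrite (eq_bigr (fun=> psi z)) => [|s /eqP -> //].
rewrite sumr_const -[psi z *+ _]mulr_natl ler_wpM2r // ler_nat.
case: (pickP [pred s | rho s == z]) => [s0 /eqP s0z|none]; last by rewrite eq_card0.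
apply: leq_trans (card_parity_kernel G).
rewrite -(card_imset _
    (f := fun s : {ffun 'I_F -> bool} => [ffun f => s f (+) s0 f])); last first.
  by move=> s s' /ffunP e; apply/ffunP => f; have := e f; rewrite !ffunE => /addIb.
apply/subset_leq_card/subsetP => _ /imsetP[s sz0 ->]; rewrite inE.
have sz : rho s = z by exact/eqP.
apply/forallP => a; have := @vertex_parityD _ _ G s s0 a.
rewrite (rho_inj s s0 (etrans sz (esym s0z)) a) addbb => d0.
by apply/negbT; rewrite -d0; apply: eq_bigr => f _; rewrite ffunE.
Qed.

Context (w q : nat -> bool -> R) (N : nat).
Context (w_gt0 : forall i b, 0 < w i b).
Context (w_unit : forall i, w i false ^+ 2 + w i true ^+ 2 = 1).
Context (N_ge : (2 * V <= N)%N).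
Context (q_law : prob_law V q).
Context (q_ge : forall i b, (i < V)%N -> (1 - N%:R^-1) * w i b ^+ 2 <= q i b).

(** [w] stands for the normalised Boltzmann weights. A pivot letter is uniform in the code but drawn
    with law [q], so it is reweighted by [1 / 2] over [q]. *)
Definition estimator u : R := 2 ^+ F * \prod_(i < V)
  (w i (letter F face_table 0 u i) *
   (if has_pivot F face_table 0 u i
    then (2 * q i (letter F face_table 0 u i))^-1 else 1)).

Lemma estimator_local : local_to V estimator.
Proof.
move=> u u' e; congr (_ * _); apply: eq_bigr => i _.
by rewrite !has_pivot_table (@letter_local _ _ _ _ V _ u u').
Qed.

Let N_ge2 : 2 <= N%:R :> R.
Proof.
rewrite ler_nat; apply: leq_trans N_ge.
by rewrite -[X in (X <= _)%N]muln1 leq_mul2l /= (vertex_gt0 G).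
Qed.

Let kappa_gt0 : 0 < 1 - N%:R^-1 :> R.
Proof. by rewrite subr_gt0 invf_lt1; have := N_ge2; lra. Qed.

Lemma law_gt0 i b : (i < V)%N -> 0 < q i b.
Proof. by move=> iV; apply: lt_le_trans (q_ge b iV); rewrite mulr_gt0 ?exprn_gt0. Qed.

Lemma estimator_ge0 u : 0 <= estimator u.
Proof.
apply: mulr_ge0; first exact: exprn_ge0.
apply: prodr_ge0 => i _; apply: mulr_ge0; first exact: ltW.
by case: ifP => // _; rewrite invr_ge0 mulr_ge0 // ltW // law_gt0.
Qed.

Lemma expect_estimator : expect V q estimator =
  \sum_(s : {ffun 'I_F -> bool}) \prod_(a < V) w a (vertex_parity G s a).
Proof.
rewrite /estimator expectZ expect_letters => [|i iV|i b iV].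
- apply: eq_bigr => s _; apply: eq_bigr => a _.
  by rewrite add0n combination_face_table.
- exact: (q_law iV).1.
- by left; rewrite gt_eqF // law_gt0.
Qed.

(** Bernoulli's inequality bounds the power below by [1 - V / N], which is at least [1 / 2] since
    [2 * V <= N]. *)
Let kappaV : (1 - N%:R^-1) ^- V <= 2 :> R.
Proof.
have bern n : 1 - n%:R / N%:R <= (1 - N%:R^-1) ^+ n :> R.
  elim: n => [|n IH]; first by rewrite mul0r subr0.
  rewrite exprS; apply: le_trans (ler_wpM2l (ltW kappa_gt0) IH).
  have : 0 <= N%:R^-1 * (n%:R / N%:R) :> R by rewrite !mulr_ge0 ?invr_ge0.
  rewrite -natr1; nra.
rewrite -[leRHS]invrK lef_pV2 ?posrE ?invr_gt0 ?exprn_gt0 //.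
apply: le_trans (bern V).
have N0 : 0 < N%:R :> R by apply: lt_le_trans N_ge2.
have : V%:R / N%:R <= 2^-1 :> R.
  rewrite ler_pdivrMr // mulrC ler_pdivlMr // mulrC -natrM ler_nat; exact: N_ge.
lra.
Qed.

(** The letters off the pivots determine a codeword by [parity_nonpivot_inj], so each restriction
    arises from at most 4 configurations; summed over all words off the pivots, the products of
    squares give 1 by [w_unit]. *)
Lemma nonpivot_sum_le :
  \sum_(s : {ffun 'I_F -> bool}) \prod_(a < V)
    (if table_pivot a then 1 else w a (vertex_parity G s a) ^+ 2) <= 4.
Proof.
(* Both [psi] and [rho] pin the pivot letters to [false], so that a sum over all words amounts to
   one over the letters off the pivots. *)
pose psi (z : {ffun 'I_V -> bool}) :=
  \prod_(a < V) (if table_pivot a then (~~ z a)%:R else w a (z a) ^+ 2).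
pose rho (s : {ffun 'I_F -> bool}) :=
  [ffun a => if table_pivot (nat_of_ord a) then false else vertex_parity G s a].
have psi_sum : \sum_z psi z = 1.
  rewrite -(bigA_distr_bigA (fun (a : 'I_V) b =>
    if table_pivot a then (~~ b)%:R else w a b ^+ 2)).
  apply: big1 => a _; rewrite big_bool /=.
  by case: table_pivot; rewrite ?add0r // addrC w_unit.
rewrite (eq_bigr (fun s => psi (rho s))) => [|s _]; last first.
  by apply: eq_bigr => a _; rewrite ffunE; case: ifP.
apply: (@le_trans _ _ (4 * \sum_z psi z)); last by rewrite psi_sum mulr1.
apply: sum_fibers_le => [z|s s' e a].
  by apply: prodr_ge0 => a _; case: ifP => _; rewrite ?exprn_ge0 // ltW.
pose d : {ffun 'I_F -> bool} := [ffun f => s f (+) s' f].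
have dE b : vertex_parity G d b = vertex_parity G s b (+) vertex_parity G s' b.
  rewrite -vertex_parityD /vertex_parity.
  by apply: eq_bigr => f _; rewrite ffunE.
have : vertex_parity G d a = false.
  apply: parity_nonpivot_inj => b pb; rewrite dE.
  by have /ffunP/(_ b) := e; rewrite !ffunE (negbTE pb) => ->; rewrite addbb.
by rewrite dE => /negbT; rewrite negb_add => /eqP.
Qed.

(** The squared estimator is [2 ^ F] times an estimator for the weights [g], so [expect_letters]
    applies again. At a pivot, [q_ge] bounds [g] by [(1 - 1 / N)^-1 / 2]: the amplitude disappears,
    and only the letters off the pivots remain to be summed. *)
Lemma expect_estimator_sqr : expect V q (fun u => estimator u ^+ 2) <= 32.
Proof.
pose g i b := w i b ^+ 2 * (if table_pivot i then (2 * q i b)^-1 else 1).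
have kap0 := kappa_gt0.
rewrite (@eq_expect _ _ _ _ (fun u => 2 ^+ F * (2 ^+ F * \prod_(i < V)
  (g i (letter F face_table 0 u i) *
   (if has_pivot F face_table 0 u i
    then (2 * q i (letter F face_table 0 u i))^-1 else 1))))); last first.
  move=> u; rewrite /estimator exprMn expr2 -mulrA; do 2 congr (_ * _).
  rewrite -prodrXl; apply: eq_bigr => i _.
  by rewrite exprMn /g has_pivot_table; case: table_pivot; ring.
rewrite !expectZ expect_letters => [|i iV|i b iV]; last 2 first.
- exact: (q_law iV).1.
- by left; rewrite gt_eqF // law_gt0.
pose k := (1 - N%:R^-1) ^- V * \prod_(i < V) (if table_pivot i then 2^-1 else 1) : R.
have k0 : 0 <= k.
  apply: mulr_ge0; first by rewrite invr_ge0 exprn_ge0 // ltW.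
  by apply: prodr_ge0 => i _; case: ifP => _; rewrite ?invr_ge0 ?ler0n ?ler01.
have term_le (s : {ffun 'I_F -> bool}) :
    \prod_(i < V) g i (combination face_table s (0 + i)) <=
    k * \prod_(a < V) (if table_pivot a then 1 else w a (vertex_parity G s a) ^+ 2).
  rewrite /k -exprVn -[X in X ^+ V]/((1 - N%:R^-1)^-1) -[X in _ ^+ X]card_ord.
  rewrite -prodr_const -!big_split /=; apply: ler_prod => i _.
  rewrite add0n combination_face_table /g; set b := vertex_parity _ _ _.
  have qi := law_gt0 b (ltn_ord i); have qk := q_ge b (ltn_ord i).
  have w2 : 0 <= w i b ^+ 2 by rewrite exprn_ge0 ?ltW.
  case: table_pivot; rewrite ?mulr1; last first.
    rewrite w2 /= ler_peMl //.
    by rewrite invf_ge1 // gerBl invr_ge0.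
  rewrite divr_ge0 //=; last by rewrite mulr_ge0 // ltW.
  rewrite ler_pdivrMr ?mulr_gt0 //.
  have -> : (1 - N%:R^-1)^-1 / 2 * (2 * q i b) = (1 - N%:R^-1)^-1 * q i b.
    by rewrite mulrA mulfVK ?pnatr_eq0.
  by rewrite ler_pdivlMl.
apply: (@le_trans _ _ (2 ^+ F * (k * 4))).
  apply: ler_wpM2l; first exact: exprn_ge0.
  apply: le_trans (ler_sum _ (fun s _ => term_le s)) _.
  by rewrite -mulr_sumr; apply: ler_wpM2l => //; exact: nonpivot_sum_le.
(* The bound 32 is 4 from [nonpivot_sum_le], times 2 from [kappaV], times 4 from [prod_pivot_le]. *)
rewrite /k; set P := \prod_(i < V) _.
have := prod_pivot_le; rewrite -/P; have := kappaV; set c := _ ^- V => c2 P4.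
have c0 : 0 <= c by rewrite invr_ge0 exprn_ge0 // ltW.
have -> : 2 ^+ F * (c * P * 4) = 4 * (c * (2 ^+ F * P)) by ring.
have : c * (2 ^+ F * P) <= 2 * 4.
  apply: ler_pM => //; apply: mulr_ge0; first exact: exprn_ge0.
  by apply: prodr_ge0 => i _; case: ifP => _; rewrite ?invr_ge0 ?ler0n ?ler01.
lra.
Qed.

End Moments.

(** * The program *)

(* Memory layout after the input: integer variables [0..9], then the work table
   with [V] rows and [F.+1] columns; real variables after the couplings. *)
Definition cellV : iexp := ICell (INum 0).
Definition cellF : iexp := ICell (INum 1).
Definition ivar_addr k : iexp := IAdd (INum (k + 2)) (IMul cellV cellF).
Definition ivar k : iexp := ICell (ivar_addr k).
Definition rvar_addr k : iexp := IAdd (INum (k + 3)) cellV.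
Definition rvar k : rexp := RCell (rvar_addr k).
Definition input_entry i j : iexp := ICell (IAdd (INum 2) (IAdd (IMul i cellF) j)).
Definition table_addr i j : iexp :=
  IAdd (IAdd (INum 12) (IMul cellV cellF)) (IAdd (IMul i (IAdd cellF (INum 1))) j).
Definition table_entry i j : iexp := ICell (table_addr i j).
Definition coupling i : rexp := RCell (IAdd (INum 3) i).
Definition set_ivar k e : cmd := ISet (ivar_addr k) e.
Definition set_rvar k e : cmd := RSet (rvar_addr k) e.
Definition xor_exp e f : iexp := ISub (IAdd e f) (IMul (INum 2) (IMul e f)).
Definition num n : rexp := ROfInt (INum n).

Definition for_loop k bound body : cmd :=
  Seq (set_ivar k (INum 0))
    (Seq (While (BNot (BILe bound (ivar k)))
           (Seq body (set_ivar k (IAdd (ivar k) (INum 1)))))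
         (set_ivar k (INum 0))).

Local Notation vI := 0%N (only parsing).
Local Notation vJ := 1%N (only parsing).
Local Notation vA := 2%N (only parsing).
Local Notation vPivot := 3%N (only parsing).
Local Notation vN := 4%N (only parsing).
Local Notation vDraw := 5%N (only parsing).
Local Notation vBit := 6%N (only parsing).
Local Notation vThreshold := 7%N (only parsing).
Local Notation vLetter := 8%N (only parsing).
Local Notation vSamples := 9%N (only parsing).
Local Notation rSum := 0%N (only parsing).
Local Notation rWeight := 1%N (only parsing).
Local Notation rNorm := 2%N (only parsing).
Local Notation rProb := 3%N (only parsing).
Local Notation rSqnorm := 4%N (only parsing).

Definition copy_table : cmd :=
  for_loop vI cellV
    (Seq (for_loop vJ cellF
           (ISet (table_addr (ivar vI) (IAdd (ivar vJ) (INum 1)))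
                 (input_entry (ivar vI) (ivar vJ))))
         (ISet (table_addr (ivar vI) (INum 0)) (INum 0))).

(** One bit is read per doubling of [vN], so [vDraw] ends up uniform below [vN], the first power of
    2 that reaches [2 * V]. *)
Definition draw_bits : cmd :=
  While (BNot (BILe (IMul (INum 2) cellV) (ivar vN)))
    (Seq (Toss (ivar_addr vBit))
    (Seq (set_ivar vDraw (IAdd (IMul (INum 2) (ivar vDraw)) (ivar vBit)))
    (Seq (set_ivar vBit (INum 0))
         (set_ivar vN (IMul (INum 2) (ivar vN)))))).

(** The machine cannot round reals, so the ceiling is found by counting up; the count stays below
    [vN], which is linear in [V]. *)
Definition find_threshold : cmd :=
  While (BNot (BRLe (RMul (rvar rProb) (ROfInt (ISub (ivar vN) (INum 1))))
                    (ROfInt (ivar vThreshold))))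
    (set_ivar vThreshold (IAdd (ivar vThreshold) (INum 1))).

Definition find_pivot : cmd :=
  for_loop vJ cellF
    (If (BIEq (table_entry (ivar vA) (IAdd (ivar vJ) (INum 1))) (INum 1))
        (set_ivar vPivot (IAdd (ivar vJ) (INum 1))) Skip).

(** The table is updated in place; [vBit] saves the entry in row [a], which is overwritten during
    the pass over its column. *)
Definition eliminate_cmd : cmd :=
  for_loop vJ (IAdd cellF (INum 1))
    (Seq (set_ivar vBit (table_entry (ivar vA) (ivar vJ)))
    (Seq (for_loop vI cellV
            (ISet (table_addr (ivar vI) (ivar vJ))
               (xor_exp (table_entry (ivar vI) (ivar vJ))
                        (IMul (ivar vBit) (table_entry (ivar vI) (ivar vPivot))))))
         (set_ivar vBit (INum 0)))).

Definition set_norm_and_prob : cmd :=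
  Seq (set_rvar rSqnorm
        (RAdd (RExp (RMul (RMul (num 2) (RCell (INum 0))) (coupling (ivar vA))))
              (RExp (RMul (RMul (RSub (num 0) (num 2)) (RCell (INum 0)))
                          (coupling (ivar vA))))))
      (set_rvar rProb
        (RDiv (RExp (RMul (RMul (RSub (num 0) (num 2)) (RCell (INum 0)))
                          (coupling (ivar vA))))
              (rvar rSqnorm))).

Definition draw_letter : cmd :=
  Seq (set_ivar vN (INum 1))
  (Seq draw_bits
  (Seq find_threshold
       (If (BNot (BILe (ivar vThreshold) (ivar vDraw)))
           (set_ivar vLetter (INum 1)) (set_ivar vLetter (INum 0))))).

Definition apply_pivot : cmd :=
  If (BIEq (ivar vPivot) (INum 0))
     (set_ivar vLetter (table_entry (ivar vA) (INum 0)))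
     (Seq (ISet (table_addr (ivar vA) (INum 0))
             (xor_exp (table_entry (ivar vA) (INum 0)) (ivar vLetter)))
     (Seq eliminate_cmd
          (set_rvar rWeight
            (RDiv (rvar rWeight)
               (RMul (num 2)
                 (RDiv (ROfInt (IAdd (IMul (ivar vLetter) (ivar vThreshold))
                          (IMul (ISub (INum 1) (ivar vLetter))
                                (ISub (ivar vN) (ivar vThreshold)))))
                    (ROfInt (ivar vN)))))))).

Definition update_weight : cmd :=
  Seq (set_rvar rWeight
        (RMul (rvar rWeight)
           (RDiv (RExp (RMul (RMul (RCell (INum 0)) (coupling (ivar vA)))
                    (RSub (num 1) (RMul (num 2) (ROfInt (ivar vLetter))))))
                 (RSqrt (rvar rSqnorm)))))
      (set_rvar rNorm (RMul (rvar rNorm) (RSqrt (rvar rSqnorm)))).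

(* Unused variables are kept at 0, so that the memory between two steps of a loop
   has a canonical description. *)
Definition reset_vars : cmd :=
  Seq (set_ivar vPivot (INum 0))
  (Seq (set_ivar vN (INum 0))
  (Seq (set_ivar vDraw (INum 0))
  (Seq (set_ivar vThreshold (INum 0))
  (Seq (set_ivar vLetter (INum 0))
  (Seq (set_rvar rProb (num 0)) (set_rvar rSqnorm (num 0))))))).

Definition visit_vertex : cmd :=
  Seq set_norm_and_prob
  (Seq draw_letter
  (Seq find_pivot
  (Seq apply_pivot
  (Seq update_weight reset_vars)))).

Definition truncation : rexp := RDiv (num 16) (RCell (INum 1)).

Definition draw_sample : cmd :=
  Seq copy_table
  (Seq (set_rvar rWeight (RExp (RMul (ROfInt cellF) (RLn (num 2)))))
  (Seq (set_rvar rNorm (num 1))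
  (Seq (for_loop vA cellV visit_vertex)
  (Seq (If (BRLe (rvar rWeight) truncation)
           (set_rvar rSum (RAdd (rvar rSum) (rvar rWeight)))
           (set_rvar rSum (RAdd (rvar rSum) truncation)))
  (Seq (set_rvar rWeight (num 0))
       (set_ivar vSamples (IAdd (ivar vSamples) (INum 1)))))))).

(** The guard is the sample size condition of [truncated_mean_estimate]; testing it before each
    sample avoids rounding a real number. *)
Definition sampling_loop : cmd :=
  While (BNot (BRLe
      (RMul (num 64) (RLn (RDiv (num 2) (RSub (num 1) (RCell (INum 2))))))
      (RMul (RMul (ROfInt (ivar vSamples)) (RCell (INum 1))) (RCell (INum 1)))))
    draw_sample.

Definition estimate_program : cmd :=
  Seq sampling_loop
  (Seq (RSet (INum 0) (RDiv (RMul (rvar rNorm) (rvar rSum)) (ROfInt (ivar vSamples))))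
       (RSet (INum 1) (num 0))).

Section EvalRules.
Context {R : realType} (s : state R).

Lemma ieval_num n : ieval s (INum n) = n. Proof. by []. Qed.
Lemma ieval_add e f : ieval s (IAdd e f) = (ieval s e + ieval s f)%N.
Proof. by []. Qed.
Lemma ieval_sub e f : ieval s (ISub e f) = (ieval s e - ieval s f)%N.
Proof. by []. Qed.
Lemma ieval_mul e f : ieval s (IMul e f) = (ieval s e * ieval s f)%N.
Proof. by []. Qed.
Lemma reval_of_int e : reval s (ROfInt e) = (ieval s e)%:R.
Proof. by []. Qed.
Lemma reval_add e f : reval s (RAdd e f) = reval s e + reval s f.
Proof. by []. Qed.
Lemma reval_sub e f : reval s (RSub e f) = reval s e - reval s f.
Proof. by []. Qed.
Lemma reval_mul e f : reval s (RMul e f) = reval s e * reval s f.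
Proof. by []. Qed.
Lemma reval_div e f : reval s (RDiv e f) = reval s e / reval s f.
Proof. by []. Qed.
Lemma reval_sqrt e : reval s (RSqrt e) = Num.sqrt (reval s e).
Proof. by []. Qed.
Lemma reval_exp e : reval s (RExp e) = expR (reval s e).
Proof. by []. Qed.
Lemma reval_ln e : reval s (RLn e) = ln (reval s e).
Proof. by []. Qed.
Lemma reval_cell n : reval s (RCell (INum n)) = reals s n.
Proof. by []. Qed.
Lemma beval_eq e f : beval s (BIEq e f) = (ieval s e == ieval s f).
Proof. by []. Qed.
Lemma beval_le e f : beval s (BILe e f) = (ieval s e <= ieval s f)%N.
Proof. by []. Qed.
Lemma beval_rle e f : beval s (BRLe e f) = (reval s e <= reval s f).
Proof. by []. Qed.
Lemma beval_not b : beval s (BNot b) = ~~ beval s b.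
Proof. by []. Qed.

Definition evalE := (beval_not, beval_eq, beval_le, beval_rle, reval_cell,
  reval_ln, reval_exp, reval_sqrt, reval_div, reval_mul, reval_sub, reval_add,
  reval_of_int, ieval_mul, ieval_sub, ieval_add, ieval_num).

End EvalRules.

(** * A program logic for total correctness with cost bounds *)

Section ProgramLogic.
Context {R : realType} (V F : nat) (T0 : nat -> nat -> bool).
Context (beta eps p : R) (J : nat -> R).

Record memory := Memory {
  ivars : seq nat;
  table : nat -> nat -> bool;
  rvars : seq R;
  bits : nat -> bool
}.

Definition set_iv k v A :=
  Memory (set_nth 0%N (ivars A) k v) (table A) (rvars A) (bits A).
Definition set_rv k v A :=
  Memory (ivars A) (table A) (set_nth 0 (rvars A) k v) (bits A).
Definition set_entry (T : nat -> nat -> bool) (i j : nat) (b : bool) :=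
  fun i' j' => if (i' == i) && (j' == j) then b else T i' j'.

(** The abstract table is a total function of which only the first [V] rows and the columns [0..F]
    are stored; [runs_table] exchanges tables that agree there. *)
Definition represents (s : state R) (A : memory) : Prop :=
  [/\ [/\ ints s 0%N = V, ints s 1%N = F,
        forall i j, (i < V)%N -> (j < F)%N -> ints s (2 + (i * F + j))%N = T0 i j.+1,
        forall k, (k < 10)%N -> ints s (k + 2 + V * F)%N = nth 0%N (ivars A) k &
        forall i j, (i < V)%N -> (j <= F)%N ->
          ints s (12 + V * F + (i * (F + 1) + j))%N = table A i j],
      [/\ reals s 0%N = beta, reals s 1%N = eps, reals s 2%N = p,
        forall a, (a < V)%N -> reals s (3 + a)%N = J a &
        forall k, reals s (k + 3 + V)%N = nth 0 (rvars A) k] &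
      coins s = bits A].

Definition runs c A A' t := forall s, represents s A ->
  exists t' s', [/\ exec c s t' s', (t' <= t)%N & represents s' A'].

Lemma runs_le c A A' t t' : runs c A A' t -> (t <= t')%N -> runs c A A' t'.
Proof.
move=> H tt' s /H[n [s' [e le r]]]; exists n, s'; split=> //.
exact: leq_trans tt'.
Qed.

Lemma represents_ext s A T : represents s A ->
  (forall i j, (i < V)%N -> (j <= F)%N -> table A i j = T i j) ->
  represents s (Memory (ivars A) T (rvars A) (bits A)).
Proof.
move=> [[h1 h2 h3 h4 h5] h6 h7] e; split=> //; split=> //= i j iV jF.
by rewrite h5 // e.
Qed.

Lemma runs_table c A v T T' r w t : runs c A (Memory v T r w) t ->
  (forall i j, (i < V)%N -> (j <= F)%N -> T i j = T' i j) ->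
  runs c A (Memory v T' r w) t.
Proof.
move=> H e s /H[n [s' [ex le re]]]; exists n, s'; split=> //.
exact: represents_ext re e.
Qed.

Lemma runs_seq c1 c2 A B C t1 t2 :
  runs c1 A B t1 -> runs c2 B C t2 -> runs (Seq c1 c2) A C (t1 + t2).
Proof.
move=> H1 H2 s /H1[n1 [s1 [e1 le1 r1]]]; have [n2 [s2 [e2 le2 r2]]] := H2 _ r1.
by exists (n1 + n2)%N, s2; split=> //; [exact: ExecSeq e2 | exact: leq_add].
Qed.

Lemma runs_skip A : runs Skip A A 1.
Proof. by move=> s r; exists 1%N, s; split=> //; exact: ExecSkip. Qed.

Lemma runs_if b c1 c2 A A' bv t1 t2 :
  (forall s, represents s A -> beval s b = bv) ->
  (bv -> runs c1 A A' t1) -> (~~ bv -> runs c2 A A' t2) ->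
  runs (If b c1 c2) A A' (bcost b + (t1 + t2)).+1.
Proof.
move=> bE H1 H2 s r; have := bE s r; case: bv H1 H2 {bE} => H1 H2 be.
  have [n [s' [e le re]]] := H1 isT s r.
  exists (bcost b + n).+1, s'; split=> //; last by lia.
  by apply: ExecIfTrue => //; rewrite be.
have [n [s' [e le re]]] := H2 isT s r.
exists (bcost b + n).+1, s'; split=> //; last by lia.
by apply: ExecIfFalse => //; rewrite be.
Qed.

Lemma runs_while b c (A : nat -> memory) n t :
  (forall i s, (i < n)%N -> represents s (A i) -> beval s b) ->
  (forall s, represents s (A n) -> ~~ beval s b) ->
  (forall i, (i < n)%N -> runs c (A i) (A i.+1) t) ->
  runs (While b c) (A 0%N) (A n) (n * (bcost b + t + 1) + (bcost b + 1)).
Proof.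
elim: n A => [|n IH] A bT bF H s r.
  exists (bcost b).+1, s; split=> //; last by lia.
  by apply: ExecWhileFalse; exact: bF.
have [n1 [s1 [e1 le1 r1]]] := H 0%N isT s r.
have [n2 [s2 [e2 le2 r2]]] := IH (fun i => A i.+1)
  (fun i s => @bT i.+1 s) bF (fun i => H i.+1) s1 r1.
exists (bcost b + n1 + n2).+1, s2; split=> //; last by lia.
by apply: ExecWhileTrue e2 => //; exact: bT r.
Qed.

Section Evaluation.
Context (s : state R) (A : memory).
Context (rep : represents s A).

Lemma int_V : ints s 0%N = V. Proof. by case: rep => -[]. Qed.
Lemma int_F : ints s 1%N = F. Proof. by case: rep => -[]. Qed.

Lemma ieval_cellV : ieval s cellV = V. Proof. exact: int_V. Qed.
Lemma ieval_cellF : ieval s cellF = F. Proof. exact: int_F. Qed.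

Lemma ieval_ivar_addr k : ieval s (ivar_addr k) = (k + 2 + V * F)%N.
Proof. by rewrite /= int_V int_F. Qed.

Lemma ieval_ivar k : (k < 10)%N -> ieval s (ivar k) = nth 0%N (ivars A) k.
Proof.
by move=> k10; rewrite /ivar -[LHS]/(ints s (ieval s (ivar_addr k))) ieval_ivar_addr;
  case: rep => -[_ _ _ h _] _ _; exact: h.
Qed.

Lemma ieval_input i j ei ej : ieval s ei = i -> ieval s ej = j ->
  (i < V)%N -> (j < F)%N -> ieval s (input_entry ei ej) = T0 i j.+1.
Proof.
move=> <- <- iV jF.
rewrite -[LHS]/(ints s (2 + (ieval s ei * ieval s cellF + ieval s ej))%N).
by rewrite [ieval s cellF]int_F; case: rep => -[_ _ h _ _] _ _; exact: h.
Qed.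

Lemma ieval_table_addr i j ei ej : ieval s ei = i -> ieval s ej = j ->
  ieval s (table_addr ei ej) = (12 + V * F + (i * (F + 1) + j))%N.
Proof. by move=> <- <-; rewrite /= int_V int_F. Qed.

Lemma ieval_table i j ei ej : ieval s ei = i -> ieval s ej = j ->
  (i < V)%N -> (j <= F)%N -> ieval s (table_entry ei ej) = table A i j.
Proof.
move=> eqi eqj iV jF; rewrite -[LHS]/(ints s (ieval s (table_addr ei ej))).
rewrite (ieval_table_addr eqi eqj).
by case: rep => -[_ _ _ _ h] _ _; exact: h.
Qed.

Lemma ieval_xor ei ej (b c : bool) : ieval s ei = b -> ieval s ej = c ->
  ieval s (xor_exp ei ej) = b (+) c.
Proof.
move=> eb ec.
rewrite -[LHS]/((ieval s ei + ieval s ej) - 2 * (ieval s ei * ieval s ej))%N.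
by rewrite eb ec; case: b c {eb ec} => -[].
Qed.

Lemma ieval_rvar_addr k : ieval s (rvar_addr k) = (k + 3 + V)%N.
Proof. by rewrite /= int_V. Qed.

Lemma reval_rvar k : reval s (rvar k) = nth 0 (rvars A) k.
Proof.
rewrite -[LHS]/(reals s (ieval s (rvar_addr k))) ieval_rvar_addr.
by case: rep => _ [_ _ _ _ h] _; exact: h.
Qed.

Lemma reval_coupling ei a : ieval s ei = a -> (a < V)%N -> reval s (coupling ei) = J a.
Proof. by move=> <-; case: rep => _ [_ _ _ h _] _; exact: h. Qed.

Lemma real_beta : reals s 0%N = beta. Proof. by case: rep => _ []. Qed.
Lemma real_eps : reals s 1%N = eps. Proof. by case: rep => _ []. Qed.
Lemma real_prob : reals s 2%N = p. Proof. by case: rep => _ []. Qed.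

End Evaluation.

Lemma table_addr_inj i j i' j' : (j <= F)%N -> (j' <= F)%N ->
  (i * (F + 1) + j = i' * (F + 1) + j')%N -> (i' == i) && (j' == j).
Proof.
move=> jF j'F e.
have l : (j < F + 1)%N by lia.
have l' : (j' < F + 1)%N by lia.
have : i' = i.
  have := congr1 (divn^~ (F + 1)%N) e.
  by rewrite !divnMDl ?addn1 // !divn_small ?addn0 // -addn1.
by move=> ii; subst i'; rewrite eqxx /=; apply/eqP; lia.
Qed.

Lemma represents_set_ivar s A k v : (k < 10)%N -> represents s A ->
  represents (set_int s (k + 2 + V * F) v) (set_iv k v A).
Proof.
move=> k10 [[h1 h2 h3 h4 h5] h6 h7]; split=> //; rewrite /= /update; split.
- by rewrite ifF //; apply/eqP; lia.
- by rewrite ifF //; apply/eqP; lia.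
- by move=> i j iV jF; rewrite ifF ?h3 //; apply/eqP; nia.
- by move=> l l10; rewrite nth_set_nth /= !eqn_add2r; case: eqP => // _; exact: h4.
- by move=> i j iV jF; rewrite ifF ?h5 //; apply/eqP; lia.
Qed.

Lemma runs_set_ivar k e v A : (k < 10)%N ->
  (forall s, represents s A -> ieval s e = v) ->
  runs (set_ivar k e) A (set_iv k v A) (8 + icost e).
Proof.
move=> k10 eE s r; exists (icost (ivar_addr k) + icost e).+1.
exists (set_int s (ieval s (ivar_addr k)) (ieval s e)).
split; first exact: ExecISet.
  by rewrite /=; lia.
by rewrite (ieval_ivar_addr r) (eE s r); exact: represents_set_ivar.
Qed.

Lemma runs_set_entry ei ej e i j (b : bool) A : (i < V)%N -> (j <= F)%N ->
  (forall s, represents s A -> ieval s ei = i) ->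
  (forall s, represents s A -> ieval s ej = j) ->
  (forall s, represents s A -> ieval s e = b) ->
  runs (ISet (table_addr ei ej) e) A
    (Memory (ivars A) (set_entry (table A) i j b) (rvars A) (bits A))
    (icost (table_addr ei ej) + icost e).+1.
Proof.
move=> iV jF eI eJ eE s r; exists (icost (table_addr ei ej) + icost e).+1.
exists (set_int s (ieval s (table_addr ei ej)) (ieval s e)).
split=> //; first exact: ExecISet.
rewrite (ieval_table_addr r (eI s r) (eJ s r)) (eE s r).
case: r => [[h1 h2 h3 h4 h5] h6 h7]; split=> //; rewrite /= /update; split.
- by case: eqP => // e1; exfalso; lia.
- by case: eqP => // e1; exfalso; lia.
- by move=> i' j' iV' jF'; case: eqP => [e1|_]; [exfalso; nia | exact: h3].
- by move=> l l10; case: eqP => [e1|_]; [exfalso; lia | exact: h4].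
move=> i' j' iV' jF'; rewrite /set_entry eqn_add2l.
case: eqP => [/esym/table_addr_inj -> //|ne]; case: ifP => [/andP[/eqP e1 /eqP e2]|_].
  by case: ne; rewrite e1 e2.
exact: h5.
Qed.

Lemma runs_set_rvar k e v A :
  (forall s, represents s A -> reval s e = v) ->
  runs (set_rvar k e) A (set_rv k v A) (5 + rcost e).
Proof.
move=> eE s r; exists (icost (rvar_addr k) + rcost e).+1.
exists (set_real s (ieval s (rvar_addr k)) (reval s e)).
split; first exact: ExecRSet.
  by rewrite /=; lia.
rewrite (ieval_rvar_addr r) (eE s r).
case: r => [h6 [h1 h2 h3 h4 h5] h7]; split=> //; rewrite /= /update; split.
- by rewrite ifF //; apply/eqP; lia.
- by rewrite ifF //; apply/eqP; lia.
- by rewrite ifF //; apply/eqP; lia.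
- by move=> a aV; rewrite ifF ?h4 //; apply/eqP; lia.
- by move=> l; rewrite nth_set_nth /= !eqn_add2r; case: eqP => // _; exact: h5.
Qed.

Lemma runs_toss k A : (k < 10)%N ->
  runs (Toss (ivar_addr k)) A
    (Memory (set_nth 0%N (ivars A) k (bits A 0%N : nat)) (table A) (rvars A)
       (fun i => bits A i.+1)) 8.
Proof.
move=> k10 s r; exists (icost (ivar_addr k)).+1, (toss_int s (ieval s (ivar_addr k))).
split=> //; first exact: ExecToss.
have [_ _ w] := r.
have [[h1 h2 h3 h4 h5] h6 h7] := represents_set_ivar (coins s 0%N) k10 r.
rewrite (ieval_ivar_addr r); split; first by rewrite -w; split.
  exact: h6.
by rewrite /= w.
Qed.

(** [A i] describes the memory apart from the counter, which [set_iv] superimposes. The summands 100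
    absorb the guard and the updates of the counter. *)
Lemma runs_for k bound body (A : nat -> memory) n t : (k < 10)%N ->
  (icost bound <= 20)%N ->
  (forall i s, represents s (set_iv k i (A i)) -> ieval s bound = n) ->
  (forall i, (i < n)%N -> runs body (set_iv k i (A i)) (set_iv k i (A i.+1)) t) ->
  runs (for_loop k bound body) (A 0%N) (set_iv k 0%N (A n)) (n * (t + 100) + 100).
Proof.
move=> k10 cb bE H.
have set_set i j B : set_iv k j (set_iv k i B) = set_iv k j B.
  by rewrite /set_iv /= set_set_nth eqxx.
have getk s i B : represents s (set_iv k i B) -> ieval s (ivar k) = i.
  by move=> r; rewrite (ieval_ivar r k10) /= nth_set_nth /= eqxx.
pose guard := BNot (BILe bound (ivar k)).
apply: (@runs_le _ _ _ ((8 + 1) + ((n * (bcost guard +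
    (t + (8 + (icost (ivar k) + 1).+1)) + 1) + (bcost guard + 1)) + (8 + 1)))%N);
  last first.
  by rewrite /ivar /ivar_addr /cellV /cellF /=; nia.
apply: runs_seq; first exact: (@runs_set_ivar k (INum 0) 0%N).
apply: runs_seq.
  apply: (@runs_while _ _ (fun i => set_iv k i (A i)) n).
  - by move=> i s i_n r; rewrite !evalE (bE i) // (getk _ _ _ r) -ltnNge.
  - by move=> s r; rewrite !evalE (bE n) // (getk _ _ _ r) leqnn.
  move=> i i_n; apply: runs_seq; first exact: H.
  rewrite -[set_iv k i.+1 _](set_set i); apply: runs_set_ivar => // s r.
  by rewrite !evalE (getk _ _ _ r) addn1.
by rewrite -[set_iv k 0%N _](set_set n); exact: (@runs_set_ivar k (INum 0) 0%N).
Qed.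

End ProgramLogic.

Ltac bound_cost :=
  rewrite /truncation /ivar /rvar /table_entry /input_entry /coupling /xor_exp /=; lia.

(** * Verification of the program against the abstract sampler *)

Section Verification.
Context {R : realType} (V F : nat) (T0 : nat -> nat -> bool).
Context (beta eps p : R) (J : nat -> R).
Context (T0_offset : forall i, T0 i 0%N = false).
Context (V_gt0 : (0 < V)%N).

Local Notation runs := (@runs R V F T0 beta eps p J).
Local Notation represents := (@represents R V F T0 beta eps p J).
Local Notation ints_at i j a pv n r t th y ns :=
  ([:: i; j; a; pv; n; r; t; th; y; ns]%N) (only parsing).

Lemma runs_copy_table ns T rv w :
  runs copy_table (Memory (ints_at 0 0 0 0 0 0 0 0 0 ns) T rv w)
    (Memory (ints_at 0 0 0 0 0 0 0 0 0 ns) T0 rv w) (V * (F * 300 + 400) + 100).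
Proof.
(* Partially copied tables: [Ti i] has the rows before [i], and [Tij i j] also the columns [1..j] of
   row [i], whose column 0 is written last. *)
pose Ti i := fun i' j' => if (i' < i)%N then T0 i' j' else T i' j'.
pose Tij i j := fun i' j' =>
  if (i' < i)%N || [&& i' == i, 0 < j' & j' <= j]%N then T0 i' j' else T i' j'.
apply: (runs_table (T := Ti V)); last first.
  by move=> i j iV _; rewrite /Ti iV.
eapply runs_le.
  apply: (runs_for (k := 0)
      (A := fun i => Memory (ints_at 0 0 0 0 0 0 0 0 0 ns) (Ti i) rv w) (n := V)) => //.
    by move=> i s r; rewrite ?evalE (ieval_cellV r).
  move=> i iV; rewrite /set_iv /=.
  apply: (runs_table (T := set_entry (Tij i F) i 0 false)); last first.
    move=> i' j' _ j'F; rewrite /set_entry /Tij /Ti ltnS [in RHS]leq_eqVlt.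
    by case: (i' =P i) => [->|_] /=; case: j' j'F => [|j'] j'F;
      rewrite ?T0_offset ?ltnn ?j'F ?orbF //=; case: (i' < i)%N.
  eapply runs_seq; last first.
    apply: (runs_set_entry (i := i) (j := 0) (b := false)
        (A := Memory (ints_at i 0 0 0 0 0 0 0 0 ns) (Tij i F) rv w)) => // s r.
    by rewrite (ieval_ivar r).
  apply: (runs_table (T := Tij i F)) => //.
  have Ti0 i' j' : Ti i i' j' = Tij i 0%N i' j'.
    by rewrite /Ti /Tij; case: j' => [|j']; rewrite ?andbF ?orbF.
  have -> : Ti i = Tij i 0%N by apply/funext => i'; apply/funext => j'.
  apply: (runs_for (k := 1)
      (A := fun j => Memory (ints_at i 0 0 0 0 0 0 0 0 ns) (Tij i j) rv w)
      (n := F) (t := 200)) => //.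
    by move=> j s r; rewrite ?evalE (ieval_cellF r).
  move=> j jF; rewrite /set_iv /=.
  apply: (runs_table (T := set_entry (Tij i j) i j.+1 (T0 i j.+1))); last first.
    move=> i' j' _ _; rewrite /set_entry /Tij.
    case: (i' =P i) => [->|_] //=; rewrite ltnn /= [(j' <= j.+1)%N]leq_eqVlt ltnS.
    by case: (j' =P j.+1) => [->|_] //=.
  eapply runs_le.
    apply: (runs_set_entry (i := i) (j := j.+1) (b := T0 i j.+1)
        (A := Memory (ints_at i j 0 0 0 0 0 0 0 ns) (Tij i j) rv w)) => // s r.
    - by rewrite (ieval_ivar r).
    - by rewrite ?evalE (ieval_ivar r) // addn1.
    - by apply: (ieval_input r) => //; rewrite (ieval_ivar r).
  bound_cost.
by bound_cost.
Qed.

Lemma runs_find_pivot a n draw th y ns T rv w : (a < V)%N ->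
  runs find_pivot (Memory (ints_at 0 0 a 0 n draw 0 th y ns) T rv w)
    (Memory (ints_at 0 0 a (pivot F T a) n draw 0 th y ns) T rv w) (F * 250 + 100).
Proof.
move=> aV; eapply runs_le.
  apply: (runs_for (k := 1) (A := fun j =>
    Memory (ints_at 0 0 a (last_one (fun j => T a j.+1) j) n draw 0 th y ns) T rv w)
      (n := F) (t := 150)) => //.
    by move=> j s r; rewrite ?evalE (ieval_cellF r).
  move=> j jF; eapply runs_le.
    apply: (runs_if (bv := T a j.+1)).
    - move=> s r; rewrite ?evalE (ieval_table r (i := a) (j := j.+1)) //.
      + by rewrite /=; case: (T a j.+1).
      + by rewrite (ieval_ivar r).
      + by rewrite ?evalE (ieval_ivar r) //= addn1.
    - move=> Tj; rewrite /set_iv /= Tj.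
      apply: (runs_set_ivar (v := j.+1)) => // s r.
      by rewrite ?evalE (ieval_ivar r) //= addn1.
    by move=> /negbTE Tj; rewrite /set_iv /= Tj; exact: runs_skip.
  by bound_cost.
by bound_cost.
Qed.

(** Columns are treated in increasing order, and those after [pv] do not change because their entry
    in row [a] is 0. The pivot column is therefore intact whenever its value matters, which is why
    the last one of the row serves as pivot. *)
Lemma runs_eliminate a pv n draw th y ns T rv w : (a < V)%N -> (pv <= F)%N ->
  (forall j, (pv < j <= F)%N -> T a j = false) ->
  runs eliminate_cmd (Memory (ints_at 0 0 a pv n draw 0 th y ns) T rv w)
    (Memory (ints_at 0 0 a pv n draw 0 th y ns) (eliminate T a pv) rv w)
    ((F + 1) * (V * 500 + 400) + 100).
Proof.
move=> aV pF T_pv.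
pose Tj j := fun i' j' => if (j' < j)%N then eliminate T a pv i' j' else T i' j'.
pose Tij j i := fun i' j' =>
  if (j' < j)%N || ((j' == j) && (i' < i)%N) then eliminate T a pv i' j' else T i' j'.
apply: (runs_table (T := Tj (F + 1)%N)); last first.
  by move=> i j _ jF; rewrite /Tj addn1 ltnS jF.
have Tj0 : T = Tj 0%N by [].
rewrite [X in Memory _ X _ _]Tj0; eapply runs_le.
  apply: (runs_for (k := 1) (A := fun j =>
    Memory (ints_at 0 0 a pv n draw 0 th y ns) (Tj j) rv w)
    (n := (F + 1)%N) (t := V * 500 + 300)) => //.
    by move=> j s r; rewrite ?evalE (ieval_cellF r).
  move=> j jF1; have jF : (j <= F)%N by rewrite addn1 ltnS in jF1.
  rewrite /set_iv /=; eapply runs_le.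
    eapply runs_seq.
      apply: (runs_set_ivar (v := T a j : nat)) => // s r.
      rewrite (ieval_table r (i := a) (j := j)) ?(ieval_ivar r) //=.
      by rewrite /Tj ltnn.
    eapply (runs_seq
        (B := Memory (ints_at 0 j a pv n draw (nat_of_bool (T a j)) th y ns)
          (Tj j.+1) rv w)); last first.
      by apply: (runs_set_ivar (v := 0%N)).
    apply: (runs_table (T := Tij j V)); last first.
      by move=> i' j' iV _; rewrite /Tij /Tj iV andbT [in RHS]ltnS [in RHS]leq_eqVlt orbC.
    have Ti0 : Tj j = Tij j 0%N.
      by apply/funext => i'; apply/funext => j'; rewrite /Tij andbF orbF.
    rewrite /set_iv /= Ti0.
    pose A i :=
      Memory (ints_at 0 j a pv n draw (nat_of_bool (T a j)) th y ns) (Tij j i) rv w.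
    apply: (runs_for (k := 0) (A := A) (n := V) (t := 400)) => //.
      by move=> i s r; rewrite ?evalE (ieval_cellV r).
    move=> i iV; rewrite /set_iv /=.
    apply: (runs_table (T := set_entry (Tij j i) i j (eliminate T a pv i j))); last first.
      move=> i' j' _ _; rewrite /set_entry /Tij ltnS [(i' <= i)%N]leq_eqVlt.
      case: (i' =P i) => [->|_] //=; case: (j' =P j) => [->|_] //=.
      by rewrite orbT.
    eapply runs_le.
      apply: (runs_set_entry (i := i) (j := j) (b := eliminate T a pv i j)
          (A := Memory (ints_at i j a pv n draw (nat_of_bool (T a j)) th y ns)
            (Tij j i) rv w)) => // s r.
      - by rewrite (ieval_ivar r).
      - by rewrite (ieval_ivar r).
      rewrite /eliminate; apply: ieval_xor.
        rewrite (ieval_table r (i := i) (j := j)) ?(ieval_ivar r) //=.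
        by rewrite /Tij !ltnn andbF.
      rewrite ?evalE (ieval_ivar r) //.
      rewrite (ieval_table r (i := i) (j := pv)) ?(ieval_ivar r) //=.
      have [Taj|] := boolP (T a j); last by rewrite mul0n.
      have jp : (j <= pv)%N.
        by rewrite leqNgt; apply/negP => pj; rewrite T_pv ?pj in Taj.
      by rewrite mul1n /Tij ltnNge jp ltnn andbF.
    by bound_cost.
  by bound_cost.
by bound_cost.
Qed.

Lemma last_one_le b n : (last_one b n <= n)%N.
Proof. by elim: n => //= n IH; case: ifP => // _; exact: leqW. Qed.

Context (m : nat).
Context (m_large : (2 * V <= 2 ^ m)%N).
Context (m_small : forall i, (i < m)%N -> (2 ^ i < 2 * V)%N).

Lemma runs_draw_bits a ns T rv w :
  runs draw_bits (Memory (ints_at 0 0 a 0 1 0 0 0 0 ns) T rv w)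
    (Memory (ints_at 0 0 a 0 (2 ^ m) (bits_value m w) 0 0 0 ns) T rv (drop_bits m w))
    (m * 200 + 50).
Proof.
eapply runs_le.
  apply: (runs_while
      (A := fun i => Memory (ints_at 0 0 a 0 (2 ^ i) (bits_value i w) 0 0 0 ns)
        T rv (drop_bits i w)) (n := m)).
  - by move=> i s im r; rewrite ?evalE (ieval_cellV r) (ieval_ivar r) //= -ltnNge m_small.
  - by move=> s r; rewrite ?evalE (ieval_cellV r) (ieval_ivar r) //= negbK.
  move=> i im; eapply runs_seq; first exact: runs_toss.
  eapply runs_seq; first (apply: (runs_set_ivar (v := bits_value i.+1 w)) => // s r).
    by rewrite ?evalE !(ieval_ivar r) //= /drop_bits addn0.
  eapply runs_seq; first exact: (runs_set_ivar (v := 0%N)).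
  have -> : drop_bits i.+1 w = fun k => drop_bits i w k.+1.
    by apply/funext => k; rewrite /drop_bits addnS.
  apply: (runs_set_ivar (v := (2 ^ i.+1)%N)) => // s r.
  by rewrite ?evalE (ieval_ivar r) //= expnS.
by bound_cost.
Qed.

Lemma runs_find_threshold a ns T S X D q sq w draw th :
  (forall i, (i < th)%N -> i%:R < q * (2 ^ m - 1)%:R) ->
  q * (2 ^ m - 1)%:R <= th%:R ->
  runs find_threshold
    (Memory (ints_at 0 0 a 0 (2 ^ m) draw 0 0 0 ns) T [:: S; X; D; q; sq] w)
    (Memory (ints_at 0 0 a 0 (2 ^ m) draw 0 th 0 ns) T [:: S; X; D; q; sq] w)
    (th * 100 + 50).
Proof.
move=> th_lt th_ge; eapply runs_le.
  apply: (runs_while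
      (A := fun i => Memory (ints_at 0 0 a 0 (2 ^ m) draw 0 i 0 ns)
        T [:: S; X; D; q; sq] w) (n := th)).
  - by move=> i s i_th r; rewrite ?evalE (reval_rvar r) !(ieval_ivar r) //= -ltNge th_lt.
  - by move=> s r; rewrite ?evalE (reval_rvar r) !(ieval_ivar r) //= negbK.
  move=> i i_th; apply: (runs_set_ivar (v := i.+1)) => // s r.
  by rewrite ?evalE (ieval_ivar r) //= addn1.
by bound_cost.
Qed.

Lemma runs_draw_letter a ns T S X D q sq w th : (th <= 2 ^ m)%N ->
  (forall i, (i < th)%N -> i%:R < q * (2 ^ m - 1)%:R) ->
  q * (2 ^ m - 1)%:R <= th%:R ->
  runs draw_letter (Memory (ints_at 0 0 a 0 0 0 0 0 0 ns) T [:: S; X; D; q; sq] w)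
    (Memory (ints_at 0 0 a 0 (2 ^ m) (bits_value m w) 0 th
               (nat_of_bool (bits_value m w < th)%N) ns)
       T [:: S; X; D; q; sq] (drop_bits m w))
    (m * 200 + 2 ^ m * 100 + 250).
Proof.
move=> th_le th_lt th_ge; eapply runs_le.
  eapply runs_seq; first exact: (runs_set_ivar (v := 1%N)).
  eapply runs_seq; first exact: runs_draw_bits.
  rewrite /=.
  eapply runs_seq; first by eapply runs_find_threshold; [exact: th_lt | exact: th_ge].
  rewrite /=.
  apply: (runs_if (bv := (bits_value m w < th)%N)).
  - by move=> s r; rewrite ?evalE !(ieval_ivar r) //= -ltnNge.
  - by move=> ->; exact: (runs_set_ivar (v := 1%N)).
  - by move=> /negbTE ->; exact: (runs_set_ivar (v := 0%N)).
by bound_cost.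
Qed.

Lemma runs_apply_pivot a draw th y ns T S X D q sq w : (a < V)%N ->
  let piv := pivot F T a in let z := if piv != 0%N then y else T a 0%N in
  runs apply_pivot
    (Memory (ints_at 0 0 a piv (2 ^ m) draw 0 th (nat_of_bool y) ns) T
       [:: S; X; D; q; sq] w)
    (Memory (ints_at 0 0 a piv (2 ^ m) draw 0 th (nat_of_bool z) ns) (step F T a y)
       [:: S;
           X * (if piv != 0%N
                then (2 * threshold_law (2 ^ m) (fun=> th) a z)^-1 else 1);
           D; q; sq] w)
    ((F + 1) * (V * 500 + 400) + 1000).
Proof.
move=> aV piv z; rewrite /z /step -/piv; clear z; eapply runs_le.
  apply: (runs_if (bv := piv == 0%N)).
  - by move=> s r; rewrite ?evalE (ieval_ivar r).
  - move=> -> /=; rewrite mulr1.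
    apply: (runs_set_ivar (v := T a 0%N : nat)) => // s r.
    by rewrite (ieval_table r (i := a) (j := 0%N)) ?(ieval_ivar r).
  move=> pivN0; rewrite (negbTE pivN0) /=.
  have pivF : (piv <= F)%N by exact: last_one_le.
  have T_piv j : (piv < j <= F)%N -> T a j = false.
    case: j => // j; rewrite ltnS => /andP[pj jF].
    by apply: (@last_one_max (fun j => T a j.+1) F); rewrite -/(pivot F T a) -/piv pj.
  eapply runs_seq.
    apply: (runs_table (T := set_entry T a 0 (T a 0%N (+) y))
      (T' := flip_bit T a y)); last first.
      move=> i j _ _; rewrite /set_entry /flip_bit.
      case: (i =P a) => [->|_] /=; last by rewrite addbF.
      by case: (j =P 0%N) => [->|_] //=; rewrite addbF.
    apply: (runs_set_entry (i := a) (j := 0) (b := T a 0%N (+) y)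
        (A := Memory (ints_at 0 0 a piv (2 ^ m) draw 0 th (nat_of_bool y) ns)
          T [:: S; X; D; q; sq] w)) => // s r.
      by rewrite (ieval_ivar r).
    apply: ieval_xor; last by rewrite (ieval_ivar r).
    by rewrite (ieval_table r (i := a) (j := 0%N)) ?(ieval_ivar r).
  rewrite /=; eapply runs_seq.
    apply: runs_eliminate => // j /andP[pj jF].
    rewrite /flip_bit T_piv ?pj //= eqxx /=.
    by case: j pj {jF}.
  apply: runs_set_rvar => s r; rewrite ?evalE !(reval_rvar r) !(ieval_ivar r) //=.
  congr (_ * (_ * (_ / _))^-1).
  by case: y {r} => /=; rewrite ?mul1n ?mul0n ?addn0 ?add0n.
by bound_cost.
Qed.

Context (F_le : (F <= 3 * V)%N).

Definition sqnorm a : R := expR (2 * beta * J a) + expR (- 2 * beta * J a).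

Definition amplitude a (b : bool) : R :=
  expR (beta * J a * (1 - 2 * (b : nat)%:R)) / Num.sqrt (sqnorm a).

Definition one_prob a : R := expR (- 2 * beta * J a) / sqnorm a.

Context (th : nat -> nat).
Context (th_le : forall a, (a < V)%N -> (th a <= 2 ^ m)%N).
Context (th_lt : forall a i, (a < V)%N -> (i < th a)%N ->
  i%:R < one_prob a * (2 ^ m - 1)%:R).
Context (th_ge : forall a, (a < V)%N -> one_prob a * (2 ^ m - 1)%:R <= (th a)%:R).

Definition letter_weight a (piv z : bool) : R :=
  amplitude a z * (if piv then (2 * threshold_law (2 ^ m) th a z)^-1 else 1).

Lemma runs_set_norm_and_prob a ns T S X D w : (a < V)%N ->
  runs set_norm_and_prob
    (Memory (ints_at 0 0 a 0 0 0 0 0 0 ns) T [:: S; X; D; 0; 0] w)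
    (Memory (ints_at 0 0 a 0 0 0 0 0 0 ns) T [:: S; X; D; one_prob a; sqnorm a] w) 200.
Proof.
move=> aV; eapply runs_le.
  eapply runs_seq.
    apply: (runs_set_rvar _ (v := sqnorm a)) => s r.
    rewrite !evalE (reval_coupling r (a := a)) ?(ieval_ivar r) //.
    by rewrite (real_beta r) sub0r.
  apply: (runs_set_rvar _ (v := one_prob a)) => s r.
  rewrite !evalE (reval_coupling r (a := a)) ?(ieval_ivar r) // (reval_rvar r).
  by rewrite (real_beta r) sub0r.
by bound_cost.
Qed.

Lemma runs_update_weight a pv n draw t (y : bool) ns T S X D q w : (a < V)%N ->
  runs update_weight
    (Memory (ints_at 0 0 a pv n draw 0 t (nat_of_bool y) ns) T
       [:: S; X; D; q; sqnorm a] w)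
    (Memory (ints_at 0 0 a pv n draw 0 t (nat_of_bool y) ns) T
       [:: S; X * amplitude a y; D * Num.sqrt (sqnorm a); q; sqnorm a] w) 200.
Proof.
move=> aV; eapply runs_le.
  eapply runs_seq.
    apply: (runs_set_rvar _ (v := X * amplitude a y)) => s r.
    rewrite !evalE (reval_coupling r (a := a)) ?(ieval_ivar r) // !(reval_rvar r).
    by rewrite (real_beta r).
  apply: (runs_set_rvar _ (v := D * Num.sqrt (sqnorm a))) => s r.
  by rewrite !evalE !(reval_rvar r).
by bound_cost.
Qed.

Lemma runs_reset_vars a pv n draw t y ns T S X D q sq w :
  runs reset_vars
    (Memory (ints_at 0 0 a pv n draw 0 t y ns) T [:: S; X; D; q; sq] w)
    (Memory (ints_at 0 0 a 0 0 0 0 0 0 ns) T [:: S; X; D; 0; 0] w) 100.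
Proof.
eapply runs_le.
  do 5 (eapply runs_seq; first exact: (runs_set_ivar (v := 0%N))).
  by eapply runs_seq; exact: (runs_set_rvar _ (v := 0)).
by bound_cost.
Qed.

Definition vertex_cost :=
  (m * 200 + 2 ^ m * 100 + F * 250 + (F + 1) * (V * 500 + 400) + 2000)%N.

Lemma runs_visit_vertex a ns T S X D w : (a < V)%N ->
  let u := (bits_value m w < th a)%N in
  let piv := pivot F T a != 0%N in
  runs visit_vertex
    (Memory (ints_at 0 0 a 0 0 0 0 0 0 ns) T [:: S; X; D; 0; 0] w)
    (Memory (ints_at 0 0 a 0 0 0 0 0 0 ns) (step F T a u)
       [:: S; X * letter_weight a piv (if piv then u else T a 0%N);
           D * Num.sqrt (sqnorm a); 0; 0] (drop_bits m w)) vertex_cost.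
Proof.
move=> aV u piv; eapply runs_le.
  eapply runs_seq; first exact: runs_set_norm_and_prob.
  eapply runs_seq.
    apply: (runs_draw_letter (th := th a)).
    - exact: th_le.
    - by move=> i; exact: th_lt.
    - exact: th_ge.
  eapply runs_seq; first exact: runs_find_pivot.
  eapply runs_seq; first exact: runs_apply_pivot.
  rewrite -/u -/piv /=; eapply runs_seq; first exact: runs_update_weight.
  have weightE z : X * letter_weight a piv z =
    X * (if piv then (2 * threshold_law (2 ^ m) (fun=> th a) a z)^-1 else 1) *
      amplitude a z.
    by rewrite /letter_weight mulrA mulrAC.
  rewrite weightE; exact: runs_reset_vars.
by rewrite /vertex_cost; lia.
Qed.

Definition drawn_bits (w : nat -> bool) : nat -> bool :=
  fun a => (bits_value m (drop_bits (a * m) w) < th a)%N.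

Definition weight_upto u n : R := 2 ^+ F * \prod_(i < n)
  letter_weight i (has_pivot F T0 0 u i) (letter F T0 0 u i).

Definition norm_upto n : R := \prod_(i < n) Num.sqrt (sqnorm i).

Lemma runs_vertex_loop ns S w :
  runs (for_loop vA cellV visit_vertex)
    (Memory (ints_at 0 0 0 0 0 0 0 0 0 ns) T0 [:: S; 2 ^+ F; 1; 0; 0] w)
    (Memory (ints_at 0 0 0 0 0 0 0 0 0 ns) (trajectory F T0 0 (drawn_bits w) V)
       [:: S; weight_upto (drawn_bits w) V; norm_upto V; 0; 0] (drop_bits (V * m) w))
    (V * (vertex_cost + 100) + 100).
Proof.
set u := drawn_bits w.
pose A a := Memory (ints_at 0 0 0 0 0 0 0 0 0 ns) (trajectory F T0 0 u a)
  [:: S; weight_upto u a; norm_upto a; 0; 0] (drop_bits (a * m) w).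
have -> : Memory (ints_at 0 0 0 0 0 0 0 0 0 ns) T0 [:: S; 2 ^+ F; 1; 0; 0] w = A 0%N.
  by rewrite /A /weight_upto /norm_upto !big_ord0 mulr1 mul0n.
apply: (runs_for (k := 2) (A := A) (n := V)) => //.
  by move=> i s r; rewrite (ieval_cellV r).
move=> a aV; rewrite /A /set_iv /=.
have := @runs_visit_vertex a ns (trajectory F T0 0 u a) S (weight_upto u a)
  (norm_upto a) (drop_bits (a * m) w) aV.
rewrite drop_bitsD -mulSnr /weight_upto /norm_upto !big_ord_recr /= -!mulrA.
by rewrite /letter /has_pivot add0n.
Qed.

Definition truncated_weight w : R := Num.min (weight_upto (drawn_bits w) V) (16 / eps).

Definition sample_cost := (100 * 200 * V ^ 3)%N.

Lemma runs_draw_sample ns T S D w :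
  runs draw_sample
    (Memory (ints_at 0 0 0 0 0 0 0 0 0 ns) T [:: S; 0; D; 0; 0] w)
    (Memory (ints_at 0 0 0 0 0 0 0 0 0 ns.+1) (trajectory F T0 0 (drawn_bits w) V)
       [:: S + truncated_weight w; 0; norm_upto V; 0; 0] (drop_bits (V * m) w))
    sample_cost.
Proof.
set u := drawn_bits w; eapply runs_le.
  eapply runs_seq; first exact: runs_copy_table.
  eapply runs_seq.
    apply: (runs_set_rvar _ (v := 2 ^+ F)) => s r.
    rewrite !evalE (ieval_cellF r) expRM_natl lnK //.
    by rewrite posrE.
  eapply runs_seq; first exact: (runs_set_rvar _ (v := 1)).
  eapply runs_seq; first exact: runs_vertex_loop.
  eapply (runs_seq (B := Memory (ints_at 0 0 0 0 0 0 0 0 0 ns)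
      (trajectory F T0 0 u V) [:: S + truncated_weight w; weight_upto u V; norm_upto V; 0; 0]
      (drop_bits (V * m) w))).
    have truncE s A : represents s A -> reval s truncation = 16 / eps.
      by move=> r; rewrite !evalE (real_eps r).
    apply: (runs_if (bv := weight_upto u V <= 16 / eps)).
    - by move=> s r; rewrite beval_rle (truncE _ _ r) (reval_rvar r).
    - move=> le; apply: (runs_set_rvar _ (v := S + truncated_weight w)) => s r.
      by rewrite reval_add !(reval_rvar r) /truncated_weight min_l.
    rewrite -ltNge => lt.
    apply: (runs_set_rvar _ (v := S + truncated_weight w)) => s r.
    by rewrite reval_add (truncE _ _ r) (reval_rvar r) /truncated_weight min_r // ltW.
  eapply runs_seq; first exact: (runs_set_rvar _ (v := 0)).
  apply: (runs_set_ivar (v := ns.+1)) => // s r.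
  by rewrite !evalE (ieval_ivar r) //= addn1.
(* By minimality [2 ^ m] is at most [4 * V]; with [F <= 3 * V], every cost is then bounded by a
   multiple of [V ^ 3]. *)
have N4 : (2 ^ m <= 4 * V)%N.
  move: m_small; case: (m) => [|k] small; first by rewrite expn0; lia.
  by have := small k (ltnSn k); rewrite expnS; lia.
have mN : (m < 2 ^ m)%N by exact: ltn_expl.
have V2 : (V <= V * V)%N by exact: leq_pmulr.
have V3 : (V * V <= V * V * V)%N by exact: leq_pmulr.
have FV : (F * V <= 3 * (V * V))%N by nia.
have FVV : (V * (F * V) <= 3 * (V * V * V))%N by nia.
have mV : (V * m <= 4 * (V * V))%N by nia.
have NV : (V * 2 ^ m <= 4 * (V * V))%N by nia.
rewrite /truncation /ivar /rvar /= /sample_cost /vertex_cost.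
have -> : (V ^ 3 = V * V * V)%N by rewrite !expnS expn0 muln1 mulnA.
nia.
Qed.

Context (n : nat).
Context (n_small : forall i, (i < n)%N ->
  i%:R * eps * eps < 64 * ln (2 / (1 - p))).
Context (n_large : 64 * ln (2 / (1 - p)) <= n%:R * eps * eps).

Definition sample_sum w : R :=
  \sum_(i < n) truncated_weight (drop_bits (i * (V * m)) w).

(** If [n] is 0, as for [p <= -1], no sample is drawn and the normalisation cell keeps its initial
    0; hence the case distinction. *)
Lemma runs_sampling_loop w : exists T,
  runs sampling_loop
    (Memory (ints_at 0 0 0 0 0 0 0 0 0 0) (fun _ _ => false) [:: 0; 0; 0; 0; 0] w)
    (Memory (ints_at 0 0 0 0 0 0 0 0 0 n) T
       [:: sample_sum w; 0; if n == 0%N then 0 else norm_upto V; 0; 0]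
       (drop_bits (n * (V * m)) w))
    (n * (sample_cost + 100) + 100).
Proof.
pose T k := if k is k'.+1 then
  trajectory F T0 0 (drawn_bits (drop_bits (k' * (V * m)) w)) V else fun _ _ => false.
pose A k := Memory (ints_at 0 0 0 0 0 0 0 0 0 k) (T k)
  [:: \sum_(i < k) truncated_weight (drop_bits (i * (V * m)) w); 0;
      if k == 0%N then 0 else norm_upto V; 0; 0] (drop_bits (k * (V * m)) w).
exists (T n).
have -> : Memory (ints_at 0 0 0 0 0 0 0 0 0 0) (fun _ _ => false)
    [:: 0; 0; 0; 0; 0] w = A 0%N.
  by rewrite /A big_ord0 mul0n.
have guardE k s : represents s (A k) ->
    beval s (BRLe (RMul (num 64) (RLn (RDiv (num 2) (RSub (num 1) (RCell (INum 2))))))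
      (RMul (RMul (ROfInt (ivar vSamples)) (RCell (INum 1))) (RCell (INum 1)))) =
    (64 * ln (2 / (1 - p)) <= k%:R * eps * eps).
  by move=> r; rewrite !evalE (ieval_ivar r) // (real_eps r) (real_prob r).
eapply runs_le.
  apply: (runs_while (A := A) (n := n)).
  - by move=> i s i_n r; rewrite beval_not (guardE _ _ r) -ltNge n_small.
  - by move=> s r; rewrite beval_not (guardE _ _ r) n_large.
  move=> i i_n; rewrite /A big_ord_recr /=.
  have := @runs_draw_sample i (T i)
    (\sum_(i0 < i) truncated_weight (drop_bits (i0 * (V * m)) w))
    (if i == 0%N then 0 else norm_upto V) (drop_bits (i * (V * m)) w).
  by rewrite drop_bitsD -mulSnr; apply.
by rewrite /ivar /=; lia.
Qed.

Lemma exec_estimate_program s w :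
  represents s (Memory (ints_at 0 0 0 0 0 0 0 0 0 0) (fun _ _ => false)
    [:: 0; 0; 0; 0; 0] w) ->
  exists t s', [/\ exec estimate_program s t s', (t <= n * (sample_cost + 100) + 200)%N,
    (0 < n)%N -> reals s' 0%N = norm_upto V * sample_sum w / n%:R & reals s' 1%N = 0].
Proof.
move=> r0; have [T H] := runs_sampling_loop w.
have [t [s1 [e1 le1 r1]]] := H _ r0.
eexists; eexists; split.
- by apply: ExecSeq e1 _; apply: ExecSeq; exact: ExecRSet.
- by rewrite /rvar /ivar /=; lia.
- move=> n0; transitivity (reval s1
    (RDiv (RMul (rvar rNorm) (rvar rSum)) (ROfInt (ivar vSamples)))) => //.
  rewrite !evalE !(reval_rvar r1) (ieval_ivar r1) //=.
  by rewrite gtn_eqF.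
by rewrite /= /update.
Qed.

End Verification.

(** * Correctness and running time *)

Lemma nth_allpairs_rows (A B C : Type) (g : A -> B -> C) (a0 : A) (b0 : B) (c0 : C)
    (s : seq A) (t : seq B) i j : (i < size s)%N -> (j < size t)%N ->
  nth c0 [seq g a b | a <- s, b <- t] (i * size t + j)%N = g (nth a0 s i) (nth b0 t j).
Proof.
elim: s i => // a s IH [|i] /= il jl; rewrite nth_cat size_map.
  by rewrite mul0n add0n jl (nth_map b0).
rewrite ifF; last by apply/negbTE; rewrite -leqNgt mulSn -addnA leq_addr.
by rewrite mulSn -addnA addKn IH.
Qed.

Lemma nth_enum_Ordinal n x0 i (i_n : (i < n)%N) :
  nth x0 (enum 'I_n) i = Ordinal i_n.
Proof. exact: (nth_ord_enum x0 (Ordinal i_n)). Qed.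

Section Correctness.
Context {V F : nat} (G : colex V F) {R : realType}.
Context (beta eps p : R) (J : 'I_V -> R).

Definition coupling_at (a : nat) : R := if insub a is Some b then J b else 0.

Lemma coupling_atE (a : 'I_V) : coupling_at a = J a.
Proof. by rewrite /coupling_at valK. Qed.

Local Notation sqnorm := (sqnorm beta coupling_at).
Local Notation amplitude := (amplitude beta coupling_at).
Local Notation one_prob := (one_prob beta coupling_at).
Local Notation norm := (norm_upto beta coupling_at V).

Lemma represents_input w :
  represents V F (face_table G) beta eps p coupling_at
    (input (incidence_matrix G) beta J eps p w)
    (Memory (nseq 10 0%N) (fun _ _ => false) (nseq 5 0) w).
Proof.
have nth_nseq0 (T : Type) (x : T) n k : nth x (nseq n x) k = x.
  by rewrite nth_nseq if_same.
split; [split|split|] => //.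
- move=> i j iV jF; rewrite /= -[in X in nth _ _ X](size_enum_ord F).
  rewrite (nth_allpairs_rows _ (Ordinal iV) (Ordinal jF)) ?size_enum_ord //.
  by rewrite !nth_enum_Ordinal mxE -incidence_bitE.
- move=> k _; rewrite nth_nseq0 addn2 /= nth_default //.
  by rewrite size_allpairs !size_enum_ord leq_addl.
- move=> i j _ _; apply: nth_default.
  by rewrite /= size_allpairs !size_enum_ord; lia.
- move=> a aV; rewrite /= (nth_map (Ordinal aV)) ?size_enum_ord //.
  by rewrite nth_enum_Ordinal -coupling_atE.
- move=> k; rewrite nth_nseq0 addn3 /= nth_default //.
  by rewrite size_map size_enum_ord leq_addl.
Qed.

Lemma sqnorm_gt0 a : 0 < sqnorm a.
Proof. by rewrite addr_gt0 ?expR_gt0. Qed.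

Lemma amplitude_gt0 a b : 0 < amplitude a b.
Proof. by rewrite divr_gt0 ?expR_gt0 ?sqrtr_gt0 ?sqnorm_gt0. Qed.

Lemma amplitude_sqr a b : amplitude a b ^+ 2 =
  if b then one_prob a else 1 - one_prob a.
Proof.
have n0 := sqnorm_gt0 a.
rewrite /amplitude expr_div_n sqr_sqrtr ?(ltW n0) // -expRM_natl.
have oneE : one_prob a + expR (2 * beta * coupling_at a) / sqnorm a = 1.
  by rewrite /one_prob -mulrDl addrC divff // gt_eqF.
case: b => /=; first by rewrite /one_prob; congr (expR _ / _); ring.
by rewrite -[X in _ = X - _]oneE addrAC subrr add0r; congr (expR _ / _); ring.
Qed.

Lemma one_prob_ge0 a : 0 <= one_prob a.
Proof. by rewrite divr_ge0 ?expR_ge0 // ltW // sqnorm_gt0. Qed.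

Lemma one_prob_le1 a : one_prob a <= 1.
Proof.
by rewrite -subr_ge0 -[X in 0 <= X](amplitude_sqr a false) sqr_ge0.
Qed.

(* Rounding up [one_prob a * (N - 1)], and not [one_prob a * N], ensures that
   neither outcome loses more than a factor [1 - 1 / N]. *)
Lemma threshold_law_ge N th a b : (0 < N)%N -> (th a < N)%N ->
  one_prob a * (N - 1)%:R <= (th a)%:R ->
  (forall i, (i < th a)%N -> i%:R < one_prob a * (N - 1)%:R) ->
  (1 - N%:R^-1) * amplitude a b ^+ 2 <= threshold_law N th a b.
Proof.
move=> N0 thN th_ge th_lt; rewrite amplitude_sqr /threshold_law.
have NR : 0 < N%:R :> R by rewrite ltr0n.
rewrite ler_pdivlMr // natrB // in th_ge th_lt *.
have -> (x : R) : (1 - N%:R^-1) * x * N%:R = x * (N%:R - 1) by field; rewrite gt_eqF.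
case: b => //; rewrite natrB ?(ltnW thN) // mulrBl mul1r.
(* Minimality of the ceiling leaves [N - th a >= (1 - one_prob a) * (N - 1)] for the letter
   [false]. *)
have th1 : (th a)%:R <= one_prob a * (N%:R - 1) + 1.
  case: (th a) th_lt => [_|k /(_ k (ltnSn k)) lt].
    by rewrite addr_ge0 // mulr_ge0 ?one_prob_ge0 // subr_ge0 ler1n.
  by rewrite -natr1 lerD2r ltW.
lra.
Qed.

(** The Boltzmann factor is a product over the vertices, with the product of the spins at [a] a sign
    given by the parity; [norm] collects the denominators of the amplitudes. *)
Lemma partition_functionE : partition_function G beta J =
  norm * \sum_(s : {ffun 'I_F -> bool}) \prod_(a < V) amplitude a (vertex_parity G s a).
Proof.
rewrite mulr_sumr; apply: eq_bigr => s _.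
rewrite /norm_upto -big_split /= /energy mulrNN mulr_sumr -prod_expR_sum.
  apply: eq_bigr => a _.
  rewrite /amplitude [RHS]mulrC mulfVK ?gt_eqF ?sqrtr_gt0 ?sqnorm_gt0 // coupling_atE.
  congr expR; rewrite mulrA; congr (_ * _).
  transitivity ((-1) ^+ vertex_parity G s a : R).
    by rewrite /vertex_parity; elim/big_rec2: _ => [|f x y _ ->];
      rewrite ?expr0 // signr_addb.
  by case: vertex_parity => /=; ring.
Qed.

(** The two powers of 2 under the roots differ by the factor [4 ^ 2], so the prescribed tolerance is
    [4 * eps] relative to [norm]. *)
Lemma tolerance_eq : scale_gamma (F := F) beta J / Num.sqrt (2 ^+ (F - 2)) * eps =
  norm * (4 * eps).
Proof.
have F3 := colex_face_ge3 G.
have -> : scale_gamma (F := F) beta J = Num.sqrt (2 ^+ (F + 2)) * norm.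
  by congr (_ * _); apply: eq_bigr => a _; rewrite /sqnorm coupling_atE.
have -> : 2 ^+ (F + 2) = (4 : R) ^+ 2 * 2 ^+ (F - 2).
  have -> : (F + 2 = 4 + (F - 2))%N by lia.
  by rewrite exprD; congr (_ * _); ring.
rewrite sqrtrM ?sqr_ge0 // sqrtr_sqr ger0_norm //.
have s0 : Num.sqrt (2 ^+ (F - 2)) != 0 :> R by rewrite gt_eqF // sqrtr_gt0 exprn_gt0.
by field.
Qed.

Lemma norm_gt0 : 0 < norm.
Proof. by apply: prodr_gt0 => a _; rewrite sqrtr_gt0 sqnorm_gt0. Qed.

(** The numbers [m], [th] and [n] are chosen minimal, hence are the values at which the search loops
    of the program stop. A sample consumes [L = V * m] bits. *)
Lemma estimate_program_spec : 0 < eps -> exists (n L : nat) (phi : (nat -> bool) -> R),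
  [/\ [/\ local_to L phi, forall w, 0 <= phi w,
          norm * expect L fair phi = partition_function G beta J &
          expect L fair (fun w => phi w ^+ 2) <= 32],
      64 * ln (2 / (1 - p)) <= n%:R * eps * eps,
      (forall i, (i < n)%N -> i%:R * eps * eps < 64 * ln (2 / (1 - p))) &
      forall w, exists t s',
        [/\ exec estimate_program (input (incidence_matrix G) beta J eps p w) t s',
            (t <= n * (sample_cost V + 100) + 200)%N,
            (0 < n)%N -> reals s' 0%N = norm *
              (\sum_(i < n) Num.min (phi (drop_bits (i * L) w)) (16 / eps)) / n%:R &
            reals s' 1%N = 0]].
Proof.
move=> eps0; have V0 := vertex_gt0 G; have FV := face_count_le G.
have exm : exists m, (2 * V <= 2 ^ m)%N by exists (2 * V)%N; exact: ltnW (ltn_expl _ _).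
have [m m_large m_min] := ex_minnP exm.
have m_small i : (i < m)%N -> (2 ^ i < 2 * V)%N.
  by move=> im; rewrite ltnNge; apply/negP => /m_min; rewrite leqNgt im.
have N0 : (0 < 2 ^ m)%N by rewrite expn_gt0.
have exth a : exists k, one_prob a * (2 ^ m - 1)%:R <= k%:R.
  by exists (2 ^ m - 1)%N; rewrite ler_piMl // one_prob_le1.
pose th a := ex_minn (exth a).
have thP a : [/\ one_prob a * (2 ^ m - 1)%:R <= (th a)%:R, (th a < 2 ^ m)%N &
    forall i, (i < th a)%N -> i%:R < one_prob a * (2 ^ m - 1)%:R].
  rewrite /th; case: ex_minnP => k k1 k2; split=> // [|i ik].
    apply: (@leq_ltn_trans (2 ^ m - 1)); last by lia.
    by apply: k2; rewrite ler_piMl // one_prob_le1.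
  by rewrite ltNge; apply/negP => /k2; rewrite leqNgt ik.
have exn : exists n, 64 * ln (2 / (1 - p)) <= n%:R * eps * eps.
  exists (Num.bound `|64 * ln (2 / (1 - p)) / (eps * eps)|).
  rewrite -mulrA -ler_pdivrMr ?mulr_gt0 //.
  by apply: le_trans (ler_norm _) _; rewrite ltW // archi_boundP.
have [n n_large n_min] := ex_minnP exn.
have n_small i : (i < n)%N -> i%:R * eps * eps < 64 * ln (2 / (1 - p)).
  by move=> i_n; rewrite ltNge; apply/negP => /n_min; rewrite leqNgt i_n.
pose q := threshold_law (R := R) (2 ^ m) th.
pose X := estimator G (R := R) amplitude q.
have q_law : prob_law V q.
  by apply: prob_law_threshold => // a _; have [_ /ltnW] := thP a.
have q_ge i b : (i < V)%N -> (1 - (2 ^ m)%:R^-1) * amplitude i b ^+ 2 <= q i b.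
  by move=> _; have [h1 h2 h3] := thP i; apply: threshold_law_ge.
have unit i : amplitude i false ^+ 2 + amplitude i true ^+ 2 = 1.
  by rewrite !amplitude_sqr subrK.
have X_loc : local_to V X by exact: estimator_local.
pose phi w := X (drawn_bits m th w).
have thle a : (a < V)%N -> (th a <= 2 ^ m)%N by move=> _; have [_ /ltnW] := thP a.
have phi_expect f : local_to V f ->
    expect (V * m) fair (fun w => f (drawn_bits m th w)) = expect V q f.
  exact: expect_thresholds.
exists n, (V * m)%N, phi; split=> //.
  split.
  - move=> w w' e; apply: X_loc => a aV; congr (_ < _)%N.
    by apply: bits_value_local => i im; apply: e; nia.
  - by move=> w; exact: (estimator_ge0 G amplitude_gt0 m_large q_ge).
  - rewrite phi_expect // (expect_estimator G amplitude_gt0 m_large q_law q_ge).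
    by rewrite partition_functionE.
  rewrite (phi_expect (fun u => X u ^+ 2)); last by move=> u u' e; rewrite (X_loc u u').
  exact: (expect_estimator_sqr G amplitude_gt0 unit m_large q_law q_ge).
move=> w; have := @exec_estimate_program R V F (face_table G) beta eps p coupling_at.
move=> /(_ _ V0 m m_large m_small FV th) H.
have [//|//|a i _|a _|t [s' [e le out0 out1]]] :=
  H _ _ _ _ n n_small n_large _ w (represents_input w).
- by have [_ _] := thP a; exact.
- by have [] := thP a.
by exists t, s'; split=> // /out0 ->.
Qed.

Lemma dist_real_complex (s : state R) (x : R) : reals s 1%N = 0 ->
  dist_to_real (output s) x = `|reals s 0%N - x|.
Proof.
by move=> s1; rewrite /dist_to_real /output s1 /= subr0 expr0n /= addr0 sqrtr_sqr.
Qed.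

Lemma estimate_program_correct : 0 < eps -> p < 1 ->
  halts_with_probability estimate_program
    (input (incidence_matrix G) beta J eps p)
    (fun s => dist_to_real (output s) (partition_function G beta J)
              <= scale_gamma (F := F) beta J / Num.sqrt (2 ^+ (F - 2)) * eps) p.
Proof.
move=> eps0 p1.
have [n [L [phi [[loc phi0 mean sqr] n_large _ run]]]] := estimate_program_spec eps0.
pose r := (n * (sample_cost V + 100) + 200)%N.
(* The padding by [r] makes the bit strings at least as long as any run. *)
exists (n * L + r)%N; split.
  move=> w; have [t [s' [e le _ _]]] := run w.
  by exists t, s'; split=> //; rewrite ler_nat (leq_trans le) // leq_addl.
(* For [p <= 0] any frequency will do; for [p > 0] the logarithm is positive, so at least one sample
   is drawn. *)
have [p0|p0] := leP p 0; first by apply: le_trans p0 _; rewrite divr_ge0 ?exprn_ge0.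
have n0 : (0 < n)%N.
  rewrite lt0n; apply/eqP => nE; move: n_large; rewrite nE !mul0r.
  apply/negP; rewrite -ltNge mulr_gt0 // ln_gt0 // ltr_pdivlMr; lra.
have p01 : 0 < p < 1 by rewrite p0.
have := truncated_mean_estimate r loc phi0 sqr eps0 p01 n0 n_large.
move=> /le_trans; apply; rewrite ler_pdivlMr ?exprn_gt0 // mulrC -sum_bit_streams.
rewrite -sum1_card natr_sum [leRHS]big_mkcond /=; apply: ler_sum => w _.
rewrite inE; case: ifPn => [_|]; first by rewrite lern1 leq_b1.
move=> /asboolP bad; case: (leP _ (4 * eps)) => [good|_]; last by rewrite lexx.
case: bad.
have [t [s' [e _ out0 out1]]] := run (bit_stream w).
exists t, s'; split=> //; rewrite dist_real_complex // out0 // -mean tolerance_eq.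
rewrite -mulrA -mulrBr normrM (gtr0_norm norm_gt0).
by apply: ler_wpM2l => //; exact: ltW norm_gt0.
Qed.

(** By minimality [n] exceeds [64 * ln (2 / (1 - p)) / eps ^+ 2] by at most 1. For [p >= 1 / 2] the
    logarithm is at most [2 * ln (1 / (1 - p))], whence 128; the terms with [1 / ln 2] absorb
    additive constants, because [ln (1 / (1 - p)) / eps ^+ 2 >= ln 2]. *)
Lemma estimate_program_runtime : 0 < eps -> eps <= 1 -> 2^-1 <= p -> p < 1 ->
  runtime_le estimate_program (input (incidence_matrix G) beta J eps p)
    (((128 + (ln 2)^-1) * 20100 + 200 / ln 2) *
     (V%:R ^+ 3 * (1 / eps ^+ 2) * ln (1 / (1 - p)))).
Proof.
move=> eps0 eps1 p_half p1 w.
have [n [L [phi [_ _ n_small run]]]] := estimate_program_spec eps0.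
have [t [s' [e le _ _]]] := run w; exists t, s'; split=> //.
have l2 : 0 < ln 2 :> R by rewrite ln_gt0 // ltr1n.
have q0 : 0 < 1 - p by lra.
set l := ln (1 / (1 - p)); set c := ln 2 in l2 *.
have cl : c <= l by rewrite ler_ln ?posrE ?divr_gt0 // ler_pdivlMr //; lra.
have l0 : 0 < l by exact: lt_le_trans cl.
have ln2 : ln (2 / (1 - p)) = c + l.
  by rewrite -[2 / _]mulr1 mulrAC -mulrA -/(1 / (1 - p)) lnM ?posrE ?divr_gt0.
have e2 : 0 < eps ^+ 2 by exact: exprn_gt0.
pose y := l / eps ^+ 2.
have ly : l <= y by rewrite ler_pdivlMr // ler_piMr ?(ltW l0) // exprn_ile1 // ltW.
have y0 : 0 < y by exact: lt_le_trans ly.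
have cy : 1 <= c^-1 * y by rewrite ler_pdivlMl // mulr1; exact: le_trans ly.
have nR : n%:R <= (128 + c^-1) * y.
  have : (n.-1)%:R <= 128 * y.
    case: n n_small {run le} => [_|n n_small]; first by rewrite mulr_ge0 // ltW.
    have := n_small n (ltnSn n); rewrite ln2 -mulrA -expr2 => lt.
    by rewrite mulrA ler_pdivlMr // (le_trans (ltW lt)) //; lra.
  have : n%:R <= (n.-1)%:R + 1 :> R by rewrite natr1 ler_nat; case: (n).
  rewrite mulrDl; lra.
have V1 : 1 <= V%:R ^+ 3 :> R.
  by rewrite -natrX -[1]/(1%:R) ler_nat expn_gt0 (vertex_gt0 G).
set v := V%:R ^+ 3 in V1 *.
apply: (@le_trans _ _ (n%:R * (20000 * v + 100) + 200)).
  move: le; rewrite -(ler_nat R) natrD natrM natrD /sample_cost natrM natrX natrM -/v.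
  by have -> : 100%:R * 200%:R * v = 20000 * v by ring.
have -> : v * (1 / eps ^+ 2) * l = v * y by rewrite /y; ring.
have v0 : 0 <= v by lra.
have n0 : 0 <= n%:R :> R by [].
apply: (@le_trans _ _ (n%:R * (20100 * v) + 200 * v)).
  by rewrite lerD ?ler_wpM2l //; lra.
have h1 : n%:R * (20100 * v) <= (128 + c^-1) * y * (20100 * v).
  by rewrite ler_wpM2r // mulr_ge0.
have h2 : 200 * v * 1 <= 200 * v * (c^-1 * y) by rewrite ler_wpM2l // mulr_ge0.
rewrite mulr1 in h2.
by apply: le_trans (lerD h1 h2) _; rewrite le_eqVlt; apply/orP; left; apply/eqP; ring.
Qed.

End Correctness.

Theorem theorem3 (R : realType) :
  exists c : cmd,
    (forall (V F : nat) (G : colex V F) (beta : R) (J : 'I_V -> R) (eps p : R),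
        0 <= beta -> 0 < eps -> p < 1 ->
        halts_with_probability c (input (incidence_matrix G) beta J eps p)
          (fun s => dist_to_real (output s) (partition_function G beta J)
                    <= scale_gamma (F := F) beta J / Num.sqrt (2 ^+ (F - 2)) * eps)
          p)
    /\
    (exists (K : R) (V0 : nat) (eps0 p0 : R),
        [/\ 0 < eps0, p0 < 1 &
         forall (V F : nat) (G : colex V F) (beta : R) (J : 'I_V -> R)
                (eps p : R),
           0 <= beta -> 0 < eps -> p < 1 ->
           (V0 <= V)%N -> eps <= eps0 -> p0 <= p ->
           runtime_le c (input (incidence_matrix G) beta J eps p)
             (K * (V%:R ^+ 3 * (1 / eps ^+ 2) * ln (1 / (1 - p))))]).
Proof.
exists estimate_program; split.
  by move=> V F G beta J eps p _; exact: estimate_program_correct.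
exists ((128 + (ln 2)^-1) * 20100 + 200 / ln 2), 0%N, 1, 2^-1; split=> //.
  by rewrite invf_lt1 // ltr1n.
move=> V F G beta J eps p _ eps0 p1 _ eps1 p_half.
exact: estimate_program_runtime.
Qed.
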